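(* Let $k>n$ be positive integers, and let $\Omega$ be an open subset of $\mathbb{R}^k$. If $f\in W^{1,1}_{\mathrm{loc}}(\Omega;\mathbb{R}^{2n+1})$ satisfies the weak contact equation $$\operatorname{im}\,\operatorname{wk}df_x\subset\ker\alpha(f(x))\quad\text{for }\mathcal{H}^k\text{-almost every }x\in\Omega,$$ then for $\mathcal{H}^k$-almost every $x\in\Omega$, $$\mathrm{rank}\,\operatorname{wk}df_x\le n.$$
   Context: Points of $\mathbb{R}^{2n+1}$ are written $(x_1,y_1,\ldots,x_n,y_n,t)$. The standard contact form on $\mathbb{R}^{2n+1}$ is $\alpha=dt+2\sum_{j=1}^n(x_j\,dy_j-y_j\,dx_j)$, and $\ker\alpha(p)$ denotes its kernel at the point $p$, a $2n$-dimensional subspace of $\mathbb{R}^{2n+1}$. $W^{1,1}_{\mathrm{loc}}(\Omega;\mathbb{R}^{2n+1})$ is the Sobolev space of locally integrable mappings $f\colon\Omega\to\mathbb{R}^{2n+1}$ having a locally integrable weak derivative, denoted $\operatorname{wk}df$; $\operatorname{wk}df_x\colon\mathbb{R}^k\to\mathbb{R}^{2n+1}$ is its value at $x$. $\mathcal{H}^k$ is Lebesgue measure on $\mathbb{R}^k$. *)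

(* Defs.v *)
From HB Require Import structures.
From mathcomp Require Import all_boot all_order all_algebra.
From mathcomp Require Import all_classical all_reals all_analysis.
From mathcomp Require Import measurable_realfun.

Set Implicit Arguments.
Unset Strict Implicit.
Unset Printing Implicit Defensive.

Import Order.TTheory GRing.Theory Num.Theory.
Import numFieldNormedType.Exports.

Local Open Scope classical_set_scope.
Local Open Scope ring_scope.

(** Borel sets of spaces of real matrices; R^k is ['rV[R]_k]. *)

Definition borel_mx_display : measure_display.
Proof. exact. Qed.

Section borel_mx.
Context (R : realType) (m n : nat).

Definition borel_mx : set (set 'M[R]_(m, n)) := <<s open >>.

Let borel_mx0 : borel_mx set0.
Proof. exact: sigma_algebra0. Qed.

Let borel_mxC A : borel_mx A -> borel_mx (~` A).
Proof. exact: sigma_algebraC. Qed.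

Let borel_mx_bigcup (F : (set 'M[R]_(m, n))^nat) :
  (forall i, borel_mx (F i)) -> borel_mx (\bigcup_i F i).
Proof. exact: sigma_algebra_bigcup. Qed.

HB.instance Definition _ := @isMeasurable.Build borel_mx_display 'M[R]_(m, n)
  borel_mx borel_mx0 borel_mxC borel_mx_bigcup.

Lemma open_measurable_mx (U : set 'M[R]_(m, n)) : open U -> measurable U.
Proof. exact: sub_sigma_algebra. Qed.

Lemma borel_mxE : @measurable _ 'M[R]_(m, n) = <<s open >>.
Proof. by []. Qed.

End borel_mx.

(** Lebesgue measure on R^k, as the iterated product of [lebesgue_measure]. *)

Section lebesgue_rV_def.
Context (R : realType).

Definition cons_rV n (p : measurableTypeR R * 'rV[R]_n) : 'rV[R]_(1 + n) :=
  row_mx p.1%:M p.2.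

Fixpoint lebesgue_rV n : set 'rV[R]_n -> \bar R :=
  match n return set 'rV[R]_n -> \bar R with
  | 0 => \d_(0 : 'rV[R]_0)
  | m.+1 => pushforward (@lebesgue_measure R \x @lebesgue_rV m)%E (@cons_rV m)
  end.

End lebesgue_rV_def.
Arguments lebesgue_rV {R} n.

Section lebesgue_rV_measure.
Context (R : realType).

Lemma open_rV_bigcup n (U : set 'rV[R]_n) : open U ->
  U = \bigcup_(q in [set q : 'rV[rat]_n * rat |
         ball (map_mx ratr q.1 : 'rV[R]_n) (ratr q.2) `<=` U])
        ball (map_mx ratr q.1 : 'rV[R]_n) (ratr q.2).
Proof.
move=> oU; apply/seteqP; split=> [x Ux|x [q /= qU] /qU //].
have /nbhs_ballP[e /= e0 eU] : nbhs x U by exact: open_nbhs_nbhs.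
have e20 : 0 < e / 2 by rewrite divr_gt0.
have [r] := rat_in_itvoo e20.
rewrite in_itv /= => /andP[r0 re].
have /choice[q qP] : forall i : 'I_n, exists q : rat, `|x 0 i - ratr q| < ratr r.
  move=> i.
  have xr : x 0 i - ratr r < x 0 i + ratr r.
    by rewrite ltrBlDr -addrA ltrDl addr_gt0.
  have [q] := rat_in_itvoo xr.
  by rewrite in_itv /= => /andP[q1 q2]; exists q; rewrite ltr_distlC q1.
have xq : ball (map_mx ratr (\row_i q i) : 'rV[R]_n) (ratr r) x.
  by split=> // i j; rewrite ord1 !mxE /ball /= distrC; exact: qP.
exists (\row_i q i, r) => //= y qy; apply: eU.
rewrite (splitr e); apply: (@ball_triangle _ _ (map_mx ratr (\row_i q i) : 'rV[R]_n)).
  by apply/ball_sym; apply: le_ball xq; exact: ltW.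
by apply: le_ball qy; exact: ltW.
Qed.

Lemma continuous_measurable_mx m n (f : 'M[R]_(m, n) -> R) :
  continuous f -> measurable_fun setT f.
Proof.
move=> /continuousP cf; apply: (measurability _ (RGenOpens.measurableE R)).
move=> _ [_ [a [b ->] <-]]; rewrite setTI.
by apply: open_measurable_mx; apply: cf; exact: interval_open.
Qed.

Lemma measurable_cons_rV n : measurable_fun setT (@cons_rV R n).
Proof.
apply: (measurability _ (borel_mxE R 1 _)).
move=> _ [U oU <-]; rewrite setTI (open_rV_bigcup oU) preimage_bigcup.
have mball (q : 'rV[rat]_(1 + n) * rat) :
    measurable (@cons_rV R n @^-1` ball (map_mx ratr q.1 : 'rV[R]_(1 + n)) (ratr q.2)).
  have [q0|q0] := leP (ratr q.2 : R) 0.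
    rewrite (_ : _ @^-1` _ = set0) //; apply/seteqP; split=> // x [/= r0 _].
    by move: r0; rewrite ltNge q0.
  rewrite (_ : _ @^-1` _ = (ball (ratr (q.1 0 (lshift n 0)) : R) (ratr q.2))
      `*` (ball (map_mx ratr (rsubmx q.1) : 'rV[R]_n) (ratr q.2))); last first.
    apply/seteqP; split=> [[x v] [_ /= xv]|[x v] [/= xq [_ vq]]].
      split=> /=.
        by have := xv 0 (lshift n 0); rewrite row_mxEl !mxE eqxx mulr1n.
      split=> // i j; have := xv i (rshift 1 j).
      by rewrite row_mxEr !mxE ord1.
    split=> // i j; rewrite ord1 -[j]splitK; case: (fintype.split j) => {}j /=.
      by rewrite (ord1 j) row_mxEl !mxE eqxx mulr1n.
    by have := vq 0 j; rewrite row_mxEr !mxE.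
  apply: measurableX.
    by apply: open_measurable; exact: ball_open.
  by apply: open_measurable_mx; exact: ball_open.
rewrite bigcup_mkcond; apply: countable_bigcupT_measurable => [|q]; first exact: countableP.
by case: ifP.
Qed.

Definition uncons_rV n (v : 'rV[R]_(1 + n)) : measurableTypeR R * 'rV[R]_n :=
  (v 0 0, rsubmx v).

Lemma cons_rVK n : cancel (@cons_rV R n) (@uncons_rV n).
Proof.
move=> [x v]; rewrite /uncons_rV /cons_rV /= row_mxKr; congr pair.
have -> : 0 = lshift n 0 :> 'I_(1 + n) by exact: val_inj.
by rewrite row_mxEl mxE eqxx.
Qed.

Lemma measurable_uncons_rV n : measurable_fun setT (@uncons_rV n).
Proof.
apply: measurable_fun_pair.
  by apply: continuous_measurable_mx; exact: coord_continuous.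
apply: (measurability _ (borel_mxE R 1 _)).
move=> _ [U oU <-]; rewrite setTI; apply: open_measurable_mx.
move: U oU; apply/continuousP => v W /nbhs_ballP[e /= e0 eW].
apply/nbhs_ballP; exists e => //= w [_ vw]; apply: eW.
by split=> // i j; rewrite !mxE; exact: vw.
Qed.

End lebesgue_rV_measure.

Lemma lebesgue_rV_measureP (R : realType) n :
  exists mu : {sigma_finite_measure set 'rV[R]_n -> \bar R},
    mu = lebesgue_rV n :> (set _ -> \bar R).
Proof.
elim: n => [|n [mu muE]]; first by exists \d_(0 : 'rV[R]_0).
pose P : {measure set (measurableTypeR R * 'rV[R]_n)%type -> \bar R} :=
  [the {measure set _ -> \bar R} of (@lebesgue_measure R \x mu)%E].
have sP : sigma_finite setT P.
  by case: (lebesgue_integral_fubini.measure_function_Measure_isSigmaFinite__to__measure_function_isSigmaFinite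
    (@lebesgue_measure R) mu).
pose nu : {measure set 'rV[R]_(1 + n) -> \bar R} :=
  measure_function_pushforward__canonical__measure_function_Measure P
    (@measurable_cons_rV R n).
have nuE : nu = lebesgue_rV n.+1 :> (set _ -> \bar R) by rewrite /= -muE.
have sf : sigma_finite setT nu.
  have [F FT Foo] := sP.
  exists (fun i => @uncons_rV R n @^-1` F i).
    by rewrite -preimage_bigcup -FT preimage_setT.
  move=> i; have [mF Fi] := Foo i; split.
    by rewrite -[X in measurable X]setTI; exact: measurable_uncons_rV.
  rewrite /nu /= /pushforward -comp_preimage.
  by rewrite (_ : _ \o _ = id) //; apply/funext; exact: cons_rVK.
pose HM := Measure_isSigmaFinite.Build _ _ _ nu sf.
pose nu' : {sigma_finite_measure set 'rV[R]_(1 + n) -> \bar R} :=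
  HB.pack (Measure.sort nu) (Measure.class nu) HM.
by exists nu'.
Qed.
Section lebesgue_rV_instance.
Context (R : realType) (n : nat).

Let lebesgue_rV0 : lebesgue_rV n set0 = 0 :> \bar R.
Proof. by have [mu <-] := lebesgue_rV_measureP R n; exact: measure0. Qed.

Let lebesgue_rV_ge0 (A : set 'rV[R]_n) : (0 <= lebesgue_rV n A)%E.
Proof. by have [mu <-] := lebesgue_rV_measureP R n; exact: measure_ge0. Qed.

Let lebesgue_rV_sigma_additive : semi_sigma_additive (@lebesgue_rV R n).
Proof.
by have [mu <-] := lebesgue_rV_measureP R n; exact: measure_semi_sigma_additive.
Qed.

HB.instance Definition _ := isMeasure.Build _ _ _ (@lebesgue_rV R n)
  lebesgue_rV0 lebesgue_rV_ge0 lebesgue_rV_sigma_additive.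

Let lebesgue_rV_sigma_finite : sigma_finite setT (@lebesgue_rV R n).
Proof. by have [mu <-] := lebesgue_rV_measureP R n; exact: sigma_finiteT. Qed.

HB.instance Definition _ := Measure_isSigmaFinite.Build _ _ _ (@lebesgue_rV R n)
  lebesgue_rV_sigma_finite.

End lebesgue_rV_instance.

Lemma cons_rV_ord0 (R : realType) n (p : measurableTypeR R * 'rV[R]_n) :
  (cons_rV p : 'rV[R]_n.+1) 0 ord0 = p.1.
Proof.
transitivity (cons_rV p 0 (lshift n 0)).
  by congr (fun_of_matrix _ _ _); exact: val_inj.
by rewrite row_mxEl mxE eqxx mulr1n.
Qed.

Lemma cons_rV_lift (R : realType) n (p : measurableTypeR R * 'rV[R]_n) i :
  (cons_rV p : 'rV[R]_n.+1) 0 (lift ord0 i) = p.2 0 i.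
Proof.
transitivity (cons_rV p 0 (rshift 1 i)).
  by congr (fun_of_matrix _ _ _); exact: val_inj.
by rewrite row_mxEr.
Qed.

Lemma lebesgue_rV_box (R : realType) n (A : 'I_n -> set (measurableTypeR R)) :
  (forall i, measurable (A i)) ->
  lebesgue_rV n [set v : 'rV[R]_n | forall i, A i (v 0 i)] =
  (\prod_(i < n) lebesgue_measure (A i))%E.
Proof.
elim: n A => [|n IHn] A mA; first by rewrite big_ord0 /= diracE mem_set //= => -[].
have mB : measurable [set v : 'rV[R]_n | forall i, A (lift 0 i) (v 0 i)].
  rewrite (_ : mkset _ = \bigcap_(i : 'I_n) ((fun v : 'rV[R]_n => v 0 i) @^-1` A (lift 0 i))).
    apply: fin_bigcap_measurable => [|i _]; first exact: finite_finset.
    rewrite -[X in measurable X]setTI; apply: continuous_measurable_mx => //.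
      exact: coord_continuous.
    exact: mA.
  by apply/seteqP; split=> v /= vA i; [move=> _; exact: vA|exact: (vA i I)].
rewrite big_ord_recl -IHn; last by move=> i; exact: mA.
rewrite -product_measure1E //=; congr (product_measure1 _ _ _).
apply/seteqP; split=> [[x v] /= xvA|[x v] /= [xA vA] i].
  split=> [|i].
    by have := xvA ord0; rewrite cons_rV_ord0.
  by have := xvA (lift ord0 i); rewrite cons_rV_lift.
case: (unliftP ord0 i) => [j|] ->.
  by rewrite cons_rV_lift; exact: vA.
by rewrite cons_rV_ord0.
Qed.

Section sobolev.
Context {R : realType} {k : nat}.
Local Notation mu := (@lebesgue_rV R k).
Implicit Types (Omega : set 'rV[R]_k) (u g phi : 'rV[R]_k -> R).

(** Measurability on [Omega] with respect to the completed (Lebesgue)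
    sigma-algebra.  For such functions the integral with respect to [mu], built
    from Borel simple functions, is the Lebesgue integral. *)
Definition lebesgue_measurable_on Omega u : Prop :=
  exists2 v : 'rV[R]_k -> R, measurable_fun setT v &
    {ae mu, forall x, Omega x -> u x = v x}.

Definition L1loc Omega u : Prop :=
  lebesgue_measurable_on Omega u /\
  forall K, K `<=` Omega -> compact K -> (\int[mu]_(x in K) `|u x|%:E < +oo)%E.

Definition partial (i : 'I_k) phi : 'rV[R]_k -> R := 'D_(delta_mx 0 i) phi.

Definition iter_partial (s : seq 'I_k) phi : 'rV[R]_k -> R :=
  foldr partial phi s.

Definition smooth phi : Prop := forall s : seq 'I_k,
  continuous (iter_partial s phi) /\
  forall i x, derivable (iter_partial s phi) x (delta_mx 0 i).

Definition test_function Omega phi : Prop :=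
  let supp := closure [set x | phi x != 0] in
  [/\ smooth phi, compact supp & supp `<=` Omega].

Definition weak_partial Omega (i : 'I_k) u g : Prop :=
  forall phi, test_function Omega phi ->
    \int[mu]_(x in Omega) (u x * partial i phi x) =
    - \int[mu]_(x in Omega) (g x * phi x).

(** [Df x] is the matrix of the weak differential in the convention of
    [jacobian]: it acts on row vectors by [v |-> v *m Df x], so that its
    [(i, j)] entry is the weak derivative of [f_j] in the direction [e_i]. *)
Definition is_weak_derivative m Omega (f : 'rV[R]_k -> 'rV[R]_m)
    (Df : 'rV[R]_k -> 'M[R]_(k, m)) : Prop :=
  forall i j, L1loc Omega (fun x => Df x i j) /\
    weak_partial Omega i (fun x => f x 0 j) (fun x => Df x i j).

Definition W11loc m Omega (f : 'rV[R]_k -> 'rV[R]_m) : Prop :=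
  (forall j, L1loc Omega (fun x => f x 0 j)) /\
  exists Df, is_weak_derivative Omega f Df.

End sobolev.

Section contact.
Context {R : realType} {n : nat}.
Implicit Types p v : 'rV[R]_(2 * n).+1.

(** Points are [(x_0, y_0, ..., x_(n-1), y_(n-1), t)]. *)
Definition xcoord p (j : 'I_n) : R := p 0 (inord (2 * j)).
Definition ycoord p (j : 'I_n) : R := p 0 (inord (2 * j).+1).
Definition tcoord p : R := p 0 ord_max.

Definition contact_form p v : R :=
  tcoord v + 2 * \sum_(j < n) (xcoord p j * ycoord v j - ycoord p j * xcoord v j).

Definition contact_plane p : set 'rV[R]_(2 * n).+1 :=
  [set v | contact_form p v = 0].

End contact.

(* Main.v *)
Require Import Defs.
From mathcomp Require Import all_boot all_order all_algebra.
From mathcomp Require Import all_classical all_reals all_analysis.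
From mathcomp Require Import measurable_realfun.
From mathcomp Require Import ring lra zify.

Set Implicit Arguments.
Unset Strict Implicit.
Unset Printing Implicit Defensive.

Import Order.TTheory GRing.Theory Num.Theory.
Import numFieldNormedType.Exports.

Local Open Scope classical_set_scope.
Local Open Scope ring_scope.

(** Let f = (x, y, t).  Fix two coordinate directions a and b, and let omega be the
sum of the forms dx_j /\ dy_j.  The point is that the rows of the weak differential
are isotropic almost everywhere: omega(D_a f, D_b f) = 0.  Formally this is the
exterior derivative of the contact equation dt = - 2 sum (x_j dy_j - y_j dx_j), but
the products x_j dy_j need not even be locally integrable, so the equation cannot
be differentiated as one between distributions.  It is integrated instead around
small squares.

Take the square with corners z, z + h a, z + h a + h b, z + h b.  For almost every
z, the components of f are absolutely continuous on its four sides, with the weak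
derivatives as derivatives ([difference_formula], [ae_ac_edge]).  They are bounded
there, so x_j dy_j is integrable on the sides, and the increment of t along a side
is the integral of - 2 sum (x_j dy_j - y_j dx_j) ([contact_edge_increment]).  Around
the closed square the increments of t cancel; so do those of x and y, whence one
may subtract from x and y their values at z.  After division by h ^ 2 the integral
around the square differs from 2 omega(D_a f(z), D_b f(z)) by an error controlled
by the averages of |Df - Df(z)| over the sides ([loop_estimate]).  As functions of
z these averages tend to 0 in L^1 with h, because translations are continuous in
L^1 ([translation_defect_small], [avg_error_small]); so for almost every z they are
small for some values of h ([ae_avg_errors_small]), and omega(D_a f(z), D_b f(z))
is 0 ([local_isotropy]).

Finally let alpha be the contact form at f(x).  The bilinear form
omega(v, w) + alpha(v) dt(w) is nondegenerate on the space of dimension 2n + 1, and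
it vanishes on the image of Df(x), which is isotropic for omega and contained in
the kernel of alpha.  So twice the rank of Df(x) is at most 2n + 1
([rank_isotropic]). *)

(** * Boxes and translations in the space of row vectors *)

(** An open set is a countable union of rational balls, and the preimage of a ball
of the sup norm is a finite intersection of conditions on single coordinates. *)
Lemma measurable_fun_rV (R : realType) d (T : measurableType d) n
    (F : T -> 'rV[R]_n) :
  (forall j, measurable_fun setT (fun t => F t 0 j)) -> measurable_fun setT F.
Proof.
move=> mF; apply: (measurability _ (borel_mxE R 1 _)).
move=> _ [U oU <-]; rewrite setTI (open_rV_bigcup oU) preimage_bigcup.
rewrite bigcup_mkcond; apply: countable_bigcupT_measurable => [|q]; first exact: countableP.
case: ifP => // _.
have [q0|q0] := leP (ratr q.2 : R) 0.
  rewrite (_ : _ @^-1` _ = set0) //; apply/seteqP; split=> // t [/= r0 _].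
  by move: r0; rewrite ltNge q0.
rewrite (_ : _ @^-1` _ = \bigcap_(j : 'I_n)
    ((fun t => F t 0 j) @^-1` ball (ratr (q.1 0 j) : R) (ratr q.2))); last first.
  apply/seteqP; split=> [t [_ /= qt] j _|t /= qt].
    by have := qt 0 j; rewrite mxE.
  split=> // i j; rewrite ord1 mxE; exact: (qt j I).
apply: fin_bigcap_measurable => [|j _]; first exact: finite_finset.
rewrite -[X in measurable X]setTI; apply: mF => //.
by apply: open_measurable; exact: ball_open.
Qed.

Lemma measurable_coord (R : realType) n (j : 'I_n) :
  measurable_fun setT (fun z : 'rV[R]_n => z 0 j).
Proof. by apply: continuous_measurable_mx; exact: coord_continuous. Qed.

Lemma measurable_shift (R : realType) n (v : 'rV[R]_n) :
  measurable_fun setT (fun z : 'rV[R]_n => z + v).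
Proof.
apply: measurable_fun_rV => j.
apply: (eq_measurable_fun (fun z : 'rV[R]_n => z 0 j + v 0 j)).
  by move=> z _; rewrite mxE.
by apply: measurable_funD => //; exact: measurable_coord.
Qed.

Lemma measurable_line_shift (R : realType) n (v : 'rV[R]_n) :
  measurable_fun setT
    (fun p : 'rV[R]_n * measurableTypeR R => p.1 + (p.2 : R) *: v).
Proof.
apply: measurable_fun_rV => j.
apply: (eq_measurable_fun
  (fun p : 'rV[R]_n * measurableTypeR R => p.1 0 j + (p.2 : R) * v 0 j)).
  by move=> z _; rewrite !mxE.
apply: measurable_funD.
  exact: (measurableT_comp (@measurable_coord R n j) (@measurable_fst _ _ _ _)).
by apply: measurable_funM => //; exact: measurable_snd.
Qed.

Section boxes.
Context {R : realType} {n : nat}.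
Implicit Types (l u v z : 'rV[R]_n).

Definition obox l u : set 'rV[R]_n := [set z | forall i, l 0 i < z 0 i < u 0 i].

Lemma measurable_obox l u : measurable (obox l u).
Proof.
rewrite (_ : obox l u =
    \bigcap_(i : 'I_n) ((fun z : 'rV[R]_n => z 0 i) @^-1` `]l 0 i, u 0 i[%classic)).
  apply: fin_bigcap_measurable => [|i _]; first exact: finite_finset.
  rewrite -[X in measurable X]setTI.
  by apply: (@measurable_coord R n i) => //; exact: measurable_itv.
apply/seteqP; split=> z /= h i; have := h i; rewrite /= in_itv //=.
by move=> /(_ I).
Qed.

Lemma setI_oboxE l1 u1 l2 u2 : obox l1 u1 `&` obox l2 u2 =
  obox (\row_i Num.max (l1 0 i) (l2 0 i)) (\row_i Num.min (u1 0 i) (u2 0 i)).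
Proof.
apply/seteqP; split=> [z [h1 h2] i|z h].
  have /andP[a1 b1] := h1 i; have /andP[a2 b2] := h2 i.
  by rewrite !mxE gt_max lt_min a1 a2 b1 b2.
by split=> i; have := h i; rewrite !mxE gt_max lt_min => /andP[/andP[h1 h2] /andP[h3 h4]]; apply/andP.
Qed.

Lemma setI_obox : setI_closed [set B : set 'rV[R]_n | exists l u, B = obox l u].
Proof.
by move=> _ _ [l1 [u1 ->]] [l2 [u2 ->]]; rewrite setI_oboxE; do 2 eexists.
Qed.

(** Rational balls of the sup norm are boxes, and every open set is a countable
union of them. *)
Lemma borel_obox : @measurable _ 'rV[R]_n =
  <<s [set B : set 'rV[R]_n | exists l u, B = obox l u] >>.
Proof.
apply/seteqP; split.
  apply: smallest_sub => [|U oU]; first exact: smallest_sigma_algebra.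
  rewrite (open_rV_bigcup oU) bigcup_mkcond.
  apply: (@countable_bigcupT_measurable _ (g_sigma_algebraType _)) => [|q]; first exact: countableP.
  case: ifP => _; last exact: measurable0.
  have [q0|q0] := leP (ratr q.2 : R) 0.
    rewrite (_ : ball _ _ = set0); first exact: measurable0.
    apply/seteqP; split=> // t [/= r0 _].
    by move: r0; rewrite ltNge q0.
  apply: sub_sigma_algebra.
  exists (\row_i (ratr (q.1 0 i) - ratr q.2)), (\row_i (ratr (q.1 0 i) + ratr q.2)).
  apply/seteqP; split=> [t [_ /= qt] j|t /= qt].
    by have := qt 0 j; rewrite !mxE /ball /= -ltr_distlC.
  by split=> // i j; have := qt j; rewrite ord1 !mxE /ball /= -ltr_distlC.
apply: smallest_sub; first exact: sigma_algebra_measurable.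
by move=> _ [l [u ->]]; exact: measurable_obox.
Qed.

Local Notation mu := (@lebesgue_rV R n).

Lemma lebesgue_rV_obox l u :
  mu (obox l u) = (\prod_(i < n) (Num.max 0 (u 0 i - l 0 i))%R%:E)%E.
Proof.
have -> : mu (obox l u) =
    (\prod_(i < n) lebesgue_measure (`](l 0 i)%R, (u 0 i)%R[%classic : set R))%E.
  rewrite (_ : obox l u = [set z | forall i, `](l 0 i)%R, (u 0 i)%R[%classic (z 0 i)]).
    exact: lebesgue_rV_box.
  by apply/seteqP; split=> z /= h i; have := h i; rewrite in_itv.
apply: eq_bigr => i _; rewrite lebesgue_measure_itv /= lte_fin -EFinD.
by rewrite -subr_gt0; case: ltP.
Qed.

Lemma lebesgue_rV_obox_lty l u : (mu (obox l u) < +oo)%E.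
Proof. by rewrite lebesgue_rV_obox prodEFin ltry. Qed.

(** Both sides are measures in [A] that agree on boxes. *)
Lemma lebesgue_rV_shift v (A : set 'rV[R]_n) : measurable A ->
  mu ((fun z => z + v) @^-1` A) = mu A.
Proof.
pose nu : {measure set 'rV[R]_n -> \bar R} :=
  measure_function_pushforward__canonical__measure_function_Measure
   mu (@measurable_shift R n v).
have nuE l u : nu (obox l u) = mu (obox l u).
  transitivity (mu (obox (l - v) (u - v))).
    rewrite (_ : obox (l - v) (u - v) = (fun z => z + v) @^-1` obox l u) //.
    by apply/seteqP; split=> z /= h i; have := h i; rewrite !mxE ltrBlDr ltrBrDr.
  by rewrite !lebesgue_rV_obox; apply: eq_bigr => i _; rewrite !mxE opprB addrA subrK.
move=> mA; transitivity (nu A) => //.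
pose cube N : set 'rV[R]_n := obox (const_mx (- N%:R)) (const_mx N%:R).
apply: (@measure_unique _ _ _ _ cube borel_obox setI_obox) => //.
- by move=> N; exists (const_mx (- N%:R)), (const_mx N%:R).
- apply/seteqP; split=> // z _.
  exists (Num.truncn (\sum_j `|z 0 j|)).+1 => // i; rewrite !mxE -ltr_norml.
  apply: le_lt_trans (truncnS_gt _).
  by rewrite (bigD1 i) //= lerDl sumr_ge0.
- by move=> _ [l [u ->]].
- by move=> N; rewrite nuE; exact: lebesgue_rV_obox_lty.
Qed.

End boxes.

(** * Fubini's theorem along lines *)

Lemma ae_measure0 (R : realType) d (T : measurableType d)
    (m : {measure set T -> \bar R}) (A : set T) :
  measurable A -> m A = 0 -> {ae m, forall x, ~ A x}.
Proof.
by move=> mA A0; exists A; split=> // x /=; exact: contrapT.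
Qed.

Section ae.
Context (R : realType) d (T : measurableType d) (m : {measure set T -> \bar R}).
Implicit Types P Q : T -> Prop.

Lemma ae_imp P Q : (forall x, P x -> Q x) ->
  {ae m, forall x, P x} -> {ae m, forall x, Q x}.
Proof. by move=> PQ; apply: filterS. Qed.

Lemma ae_and P Q : {ae m, forall x, P x} -> {ae m, forall x, Q x} ->
  {ae m, forall x, P x /\ Q x}.
Proof. exact: filterI. Qed.

Lemma ae_forall (I : countType) (P : I -> T -> Prop) :
  (forall i, {ae m, forall x, P i x}) -> {ae m, forall x, forall i, P i x}.
Proof.
move=> aeP.
have : m.-negligible (\bigcup_k ~` [set x | if unpickle k is Some i then P i x else True]).
  apply: negligible_bigcup => k; case: unpickle => [i|]; first exact: aeP.
  by rewrite setCT; exact: negligible_set0.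
apply: negligibleS => x /= nP; apply: contrapT => h; apply: nP => i.
apply: contrapT => nPi; apply: h; exists (pickle i) => //=.
by rewrite pickleK.
Qed.
End ae.

Section product.
Context (R : realType) d1 d2 (T1 : measurableType d1) (T2 : measurableType d2).
Variable m1 : {sigma_finite_measure set T1 -> \bar R}.
Variable m2 : {sigma_finite_measure set T2 -> \bar R}.
Implicit Types (D : set T2) (F : T1 * T2 -> \bar R).

(** Extension by zero: it turns the integral over [D] of a section into an integral
over the whole space. *)
Let patch_prod D F : T1 * T2 -> \bar R := fun p => (fun y => F (p.1, y)) \_ D p.2.

Let patch_prodE D F : patch_prod D F = F \_ (setT `*` D).
Proof.
apply/funext => -[x y]; rewrite /patch_prod /patch /=.
by rewrite in_setX in_setT /=; case: ifP.
Qed.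

Let measurable_patch_prod D F : measurable D -> measurable_fun setT F ->
  measurable_fun setT (patch_prod D F).
Proof.
move=> mD mF; rewrite patch_prodE.
apply/(measurable_restrictT _ _).1; first exact: measurableX.
exact: measurable_funTS.
Qed.

Lemma measurable_fun_integral_in D F : measurable D -> measurable_fun setT F ->
  measurable_fun setT (fun x => \int[m2]_(y in D) F (x, y))%E.
Proof.
move=> mD mF.
have h (G : T1 * T2 -> \bar R) : measurable_fun setT G -> (forall p, 0 <= G p)%E ->
    measurable_fun setT (fun x => \int[m2]_(y in D) G (x, y))%E.
  move=> mG G0.
  rewrite (_ : (fun x => _) = fubini_F m2 (patch_prod D G)); last first.
    by apply/funext => x; rewrite integral_mkcond.
  apply: measurable_fun_fubini_tonelli_F; first exact: measurable_patch_prod.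
  by move=> [x y]; rewrite /patch_prod /patch; case: ifP.
rewrite (_ : (fun x => _) = (fun x => \int[m2]_(y in D) F^\+ (x, y))%E \-
    (fun x => \int[m2]_(y in D) F^\- (x, y))%E)%E; last first.
  apply/funext => x; rewrite integralE.
  by under eq_integral do rewrite funepos_comp/=; under [X in (_ - X = _)%E]eq_integral do rewrite funeneg_comp/=.
apply: emeasurable_funB; apply: h => //.
  exact: measurable_funepos.
exact: measurable_funeneg.
Qed.

Lemma tonelli_in D F : measurable D -> measurable_fun setT F ->
  (forall p, 0 <= F p)%E ->
  (\int[m1]_x \int[m2]_(y in D) F (x, y) = \int[m2]_(y in D) \int[m1]_x F (x, y))%E.
Proof.
move=> mD mF F0.
under eq_integral do rewrite integral_mkcond.
rewrite (fubini_tonelli (patch_prod D F)); last 2 first.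
  - exact: measurable_patch_prod.
  - by move=> [x y]; rewrite /patch_prod /patch; case: ifP.
rewrite [RHS]integral_mkcond; apply: eq_integral => y _.
rewrite /patch_prod /patch /=; case: ifP => // yD.
by rewrite integral0_eq.
Qed.

Lemma fubini_in D F : measurable D -> measurable_fun setT F ->
  (\int[m1]_x \int[m2]_(y in D) `|F (x, y)| < +oo)%E ->
  (\int[m1]_x \int[m2]_(y in D) F (x, y) = \int[m2]_(y in D) \int[m1]_x F (x, y))%E.
Proof.
move=> mD mF Foo.
under eq_integral do rewrite integral_mkcond.
rewrite (Fubini (f := patch_prod D F)); last first.
  apply/integrable12ltyP; first exact: measurable_patch_prod.
  apply: le_lt_trans Foo; rewrite le_eqVlt; apply/orP; left; apply/eqP.
  apply: eq_integral => x _; rewrite [RHS]integral_mkcond.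
  by apply: eq_integral => y _; rewrite /patch_prod /patch /=; case: ifP; rewrite ?abse0.
rewrite [RHS]integral_mkcond; apply: eq_integral => y _.
rewrite /patch_prod /patch /=; case: ifP => // yD.
by rewrite integral0_eq.
Qed.

(** Fubini's theorem for null sets: an exceptional set whose sections in one
direction are null is null, so almost all its sections in the other direction
are null. *)
Lemma ae_sections (P : T1 -> T2 -> Prop) :
  measurable [set p | ~ P p.1 p.2] ->
  (forall y, {ae m1, forall x, P x y}) ->
  {ae m1, forall x, {ae m2, forall y, P x y}}.
Proof.
move=> mP Py; set A := [set p | ~ P p.1 p.2].
have A0 : (\int[m1]_x (m2 \o xsection A) x = 0)%E.
  rewrite -indic_fubini_tonelli_FE // indic_fubini_tonelli //.
  rewrite indic_fubini_tonelli_GE //; apply: integral0_eq => y _ /=.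
  apply: measure_negligible; first exact: measurable_ysection.
  have [N [mN N0 PN]] := Py y; exists N; split=> // x.
  by rewrite /ysection /= inE => Axy; exact: PN.
have mx : measurable_fun setT (m2 \o xsection A) by exact: measurable_fun_xsection.
have /(ae_eq_integral_abs m1 measurableT mx) : (\int[m1]_x `|(m2 \o xsection A) x| = 0)%E.
  by rewrite -[RHS]A0; apply: eq_integral => x _; rewrite gee0_abs //=.
apply: filterS => x /(_ I) /= A0x.
exists (xsection A x); split=> //; first exact: measurable_xsection.
by move=> y; rewrite /= /xsection /= inE.
Qed.
End product.

Section lines.
Context (R : realType) (n : nat).
Local Notation mu := (@lebesgue_rV R n).
Local Notation lam := (@lebesgue_measure R).
Implicit Types (v z : 'rV[R]_n).

Lemma ae_shift (P : 'rV[R]_n -> Prop) v :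
  {ae mu, forall z, P z} -> {ae mu, forall z, P (z + v)}.
Proof.
move=> [N [mN N0 PN]]; exists ((fun z => z + v) @^-1` N); split.
- by rewrite -[X in measurable X]setTI; exact: (measurable_shift v measurableT mN).
- by rewrite -N0; exact: lebesgue_rV_shift.
- by move=> z /= Pz; exact: PN.
Qed.

Lemma ge0_integral_shift v (F : 'rV[R]_n -> \bar R) :
  measurable_fun setT F -> (forall z, 0 <= F z)%E ->
  (\int[mu]_z F (z + v)%R = \int[mu]_z F z)%E.
Proof.
move=> mF F0.
have := @ge0_integral_pushforward _ _ _ _ R _ (measurable_shift v) mu setT F measurableT mF.
rewrite preimage_setT => <-; last by move=> z _; exact: F0.
apply: eq_measure_integral => [|mphi A mA _]; last exact: lebesgue_rV_shift.
exact: measurable_shift.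
Qed.

Lemma measurable_fun_shift v d (T : measurableType d) (F : 'rV[R]_n -> T) :
  measurable_fun setT F -> measurable_fun setT (fun z => F (z + v)).
Proof. by move=> mF; exact: (measurableT_comp mF (measurable_shift v)). Qed.

Lemma measurable_fun_line v d (T : measurableType d) (F : 'rV[R]_n -> T) :
  measurable_fun setT F ->
  measurable_fun setT (fun p : 'rV[R]_n * measurableTypeR R => F (p.1 + (p.2 : R) *: v)).
Proof. by move=> mF; exact: (measurableT_comp mF (measurable_line_shift v)). Qed.

Lemma integral_shift v (F : 'rV[R]_n -> \bar R) : measurable_fun setT F ->
  (\int[mu]_z F (z + v)%R = \int[mu]_z F z)%E.
Proof.
move=> mF; rewrite integralE [RHS]integralE; congr (_ - _)%E.
  transitivity (\int[mu]_z F^\+%E (z + v)%R)%E; first by apply: eq_integral => x _; rewrite !funeposE.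
  by apply: ge0_integral_shift => //; exact: measurable_funepos.
transitivity (\int[mu]_z F^\-%E (z + v)%R)%E; first by apply: eq_integral => x _; rewrite !funenegE.
by apply: ge0_integral_shift => //; exact: measurable_funeneg.
Qed.

Lemma integrable_shift v (F : 'rV[R]_n -> \bar R) :
  mu.-integrable setT F -> mu.-integrable setT (fun z => F (z + v)).
Proof.
move=> /integrableP[mF Foo]; apply/integrableP; split.
  exact: measurable_fun_shift.
apply: le_lt_trans Foo; rewrite le_eqVlt; apply/orP; left; apply/eqP.
apply: (@ge0_integral_shift v (abse \o F)) => [|z]; last exact: abse_ge0.
exact: measurableT_comp.
Qed.

(** Lines parallel to [v] are not parametrised by a complement of [v]; instead the
map (z, s) |-> z + s v is used, with all z.  For fixed s it preserves Lebesgue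
measure, so that this form of Fubini's theorem only needs translation
invariance and no splitting of coordinates. *)
Lemma ae_line (P : 'rV[R]_n -> Prop) v :
  {ae mu, forall z, P z} -> {ae mu, forall z, {ae lam, forall s : R, P (z + s *: v)}}.
Proof.
move=> [N [mN N0 PN]].
have : {ae mu, forall z, {ae lam, forall s : R, ~ N (z + s *: v)}}.
  apply: (@ae_sections _ _ _ _ _ mu lam (fun z (s : R) => ~ N (z + s *: v))).
    rewrite (_ : mkset _ =
      (fun p : 'rV[R]_n * measurableTypeR R => p.1 + (p.2 : R) *: v) @^-1` N).
      by rewrite -[X in measurable X]setTI; exact: (measurable_line_shift v measurableT mN).
    by apply/seteqP; split=> p /=; [exact: contrapT|move=> Np; apply].
  move=> s; apply: (@ae_shift (fun z => ~ N z)); exact: ae_measure0.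
apply: ae_imp => z; apply: ae_imp => s Ns.
by apply: contrapT => /PN.
Qed.

Lemma tonelli_line v (D : set (measurableTypeR R)) (F : 'rV[R]_n -> \bar R) :
  measurable D -> measurable_fun setT F -> (forall z, 0 <= F z)%E ->
  (\int[mu]_z \int[lam]_(s in D) F (z + s *: v)%R = (\int[mu]_z F z) * lam D)%E.
Proof.
move=> mD mF F0.
rewrite (@tonelli_in _ _ _ _ _ mu lam D (fun p => F (p.1 + (p.2 : R) *: v)%R)) //.
  rewrite -integral_cst //; apply: eq_integral => s _ /=.
  exact: ge0_integral_shift.
exact: measurable_fun_line.
Qed.
End lines.

(** * Smooth functions of one variable *)

Section smooth_bump.
Context {R : realType}.
Implicit Types (f g : R -> R) (p : {poly R}).

(** The functions p(1/t) exp(-1/t), extended by 0 to t <= 0, are the derivatives of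
all orders of exp(-1/t) and their linear combinations. *)
Definition flat_exp p (t : R) : R :=
  if 0 < t then p.[t^-1] * expR (- t^-1) else 0.

(** A class that contains the bumps below and is stable under differentiation, so
that its members are smooth without any bookkeeping of the order of derivatives. *)
Inductive elementary : (R -> R) -> Prop :=
| elementary_flat p : elementary (flat_exp p)
| elementary_cst c : elementary (fun=> c)
| elementary_add f g : elementary f -> elementary g ->
    elementary (fun t => f t + g t)
| elementary_mul f g : elementary f -> elementary g ->
    elementary (fun t => f t * g t)
| elementary_affine c d f : elementary f -> elementary (fun t => f (c * t + d)).

Lemma exprn_le_expR n (x : R) : 0 <= x -> x ^+ n <= n`!%:R * expR x.
Proof.
case: n => [|n] x0; first by rewrite expr0 mul1r -expR0 ler_expR.
rewrite mulrC -ler_pdivrMr ?ltr0n ?fact_gt0 //.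
by apply: le_trans (expR_ge1Dxn n x0); rewrite lerDr.
Qed.

Lemma horner_le_expR p : exists C : R, forall x : R, 0 <= x -> `|p.[x]| <= C * expR x.
Proof.
exists (\sum_(i < size p) `|p`_i| * i`!%:R) => x x0.
rewrite horner_coef mulr_suml; apply: le_trans (ler_norm_sum _ _ _) _.
apply: ler_sum => i _; rewrite normrM -mulrA ler_wpM2l // ger0_norm ?exprn_ge0 //.
exact: exprn_le_expR.
Qed.

(** The chain rule away from 0; at 0 the exponential beats every power of 1/t. *)
Lemma is_derive_flat_exp p (t : R) :
  is_derive t 1 (flat_exp p) (flat_exp ('X^2 * (p - p^`())) t).
Proof.
have [t0|t0|->] := ltgtP t 0.
- have -> : flat_exp ('X^2 * (p - p^`())) t = 0.
    by rewrite /flat_exp ltNge (ltW t0).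
  apply: (@near_eq_is_derive _ _ _ (cst 0)) => //.
  near=> s; rewrite /flat_exp /cst ltNge.
  by rewrite ltW //; near: s; exact: lt_nbhsl.
- have -> : flat_exp ('X^2 * (p - p^`())) t =
      t ^- 2 * (p.[t^-1] - p^`().[t^-1]) * expR (- t^-1).
    by rewrite /flat_exp t0 !hornerE exprVn.
  have dV : is_derive t 1 (fun t : R => t^-1) (- t ^- 2).
    by apply: is_derive_eq; [apply: is_deriveV; rewrite gt_eqF|rewrite /GRing.scale /= mulr1].
  have dp : is_derive t 1 (fun t : R => p.[t^-1]) (p^`().[t^-1] * - t ^- 2).
    apply: (@is_derive1_comp _ (horner p) (fun t : R => t^-1)).
  have dN : is_derive t 1 (fun t : R => - t^-1) (t ^- 2).
    by apply: is_derive_eq; rewrite opprK.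
  have de : is_derive t 1 (fun t : R => expR (- t^-1)) (expR (- t^-1) * t ^- 2).
    by apply: (@is_derive1_comp _ expR (fun t : R => - t^-1)).
  apply: (near_eq_is_derive (f := (fun t : R => p.[t^-1]) * (fun t : R => expR (- t^-1)))).
    near=> s; rewrite /flat_exp.
    by rewrite ifT //; near: s; exact: lt_nbhsr.
  apply: (is_derive_eq (is_deriveM dp de)).
  rewrite /GRing.scale /=; ring.
- have -> : flat_exp ('X^2 * (p - p^`())) 0 = 0 by rewrite /flat_exp ltxx.
  have p0 : flat_exp p 0 = 0 by rewrite /flat_exp ltxx.
  suff h : (fun h => h^-1 *: ((flat_exp p \o shift 0) (h *: 1) - flat_exp p 0))
      @ 0^' --> (0 : R).
    by apply: DeriveDef; [apply/cvg_ex; exists 0|exact: cvg_lim h].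
  have [C hC] := horner_le_expR ('X^2 * p).
  have C0 : 0 <= C.
    by have := le_trans (normr_ge0 _) (hC 0 (lexx _)); rewrite expR0 mulr1.
  have C1 : 0 < C + 1 by rewrite ltr_wpDl.
  apply/cvgrPdist_le => e e0; near=> h.
  rewrite sub0r normrN p0 subr0 /= addr0 /GRing.scale /= mulr1 /flat_exp.
  case: ifPn => [h0|_]; last by rewrite mulr0 normr0 ltW.
  have := hC h^-1; rewrite invr_ge0 (ltW h0) => /(_ isT).
  rewrite !hornerE exprVn normrM => hC'.
  (* x ^ 2 p(x) = O(exp x), read at x = 1 / h, gives flat_exp p h = O(h ^ 2) *)
  rewrite !normrM (ger0_norm (expR_ge0 _)) expRN.
  rewrite gtr0_norm ?invr_gt0 //.
  have hCe : `|h| * C <= e.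
    apply: (@le_trans _ _ (`|h| * (C + 1))).
      by rewrite ler_wpM2l // lerDl.
    rewrite -ler_pdivlMr //.
    by near: h; apply: dnbhs0_le; rewrite divr_gt0.
  apply: le_trans hCe; rewrite (gtr0_norm h0).
  rewrite ler_pdivrMr ?expR_gt0 // -mulrA -ler_pdivrMl //.
  apply: le_trans hC'; rewrite mulrA ler_wpM2r //.
  by rewrite gtr0_norm ?invr_gt0 ?exprn_gt0 // expr2 invfM.
Unshelve. all: by end_near. Qed.

Lemma elementary_derive f : elementary f ->
  exists2 g, elementary g & forall x : R, is_derive x 1 f (g x).
Proof.
elim=> {f} [p|c|f g _ [f' Ef' df] _ [g' Eg' dg]|f g Ef [f' Ef' df] Eg [g' Eg' dg]|c d f _ [f' Ef' df]].
- exists (flat_exp ('X^2 * (p - p^`()))) => [|x]; first exact: elementary_flat.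
  exact: is_derive_flat_exp.
- by exists (fun=> 0) => [|x]; [exact: elementary_cst|exact: is_derive_cst].
- exists (fun t => f' t + g' t) => [|x]; first exact: elementary_add.
  exact: (is_deriveD (df x) (dg x)).
- exists (fun t => f t * g' t + g t * f' t) => [|x].
    by apply: elementary_add; apply: elementary_mul.
  exact: (is_deriveM (df x) (dg x)).
- exists (fun t => f' (c * t + d) * (fun=> c) t) => [|x].
    by apply: elementary_mul; [exact: elementary_affine|exact: elementary_cst].
  apply: (@is_derive1_comp _ f (fun t : R => c * t + d)) => //.
  have h := is_deriveD (is_deriveZ c (is_derive_id x (1 : R))) (is_derive_cst d x (1 : R)).
  by apply: (is_derive_eq h); rewrite addr0 /GRing.scale /= mulr1.
Qed.

Lemma elementary_derivable f (x : R) : elementary f -> derivable f x 1.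
Proof. by move=> /elementary_derive[g _ /(_ x) []]. Qed.

Lemma elementary_derive1 f : elementary f -> elementary (derive1 f).
Proof.
move=> /elementary_derive[g Eg dg]; rewrite (_ : (derive1 f) = g) //.
by apply/funext => x; rewrite derive1E; have [] := dg x.
Qed.

Lemma elementary_continuous f : elementary f -> continuous f.
Proof.
move=> Ef x; apply: differentiable_continuous.
by apply/derivable1_diffP; exact: elementary_derivable.
Qed.

End smooth_bump.

(** * Smooth bumps on boxes *)

Section tensor.
Context {R : realType} {k : nat}.
Implicit Types (f : 'I_k -> R -> R) (z a b : 'rV[R]_k).

Definition tensor f z : R := \prod_i f i (z 0 i).

Lemma tensor_continuous f : (forall i, elementary (f i)) -> continuous (tensor f).
Proof.
move=> Ef; rewrite /tensor.
apply: continuous_big => [|i _]; first by move=> p; exact: mul_continuous.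
move=> z; apply: continuous_comp; first exact: coord_continuous.
exact: elementary_continuous.
Qed.

Lemma is_derive_tensor f (i : 'I_k) z : (forall i, elementary (f i)) ->
  is_derive z (delta_mx 0 i) (tensor f)
    (tensor (fun j => if j == i then derive1 (f j) else f j) z).
Proof.
move=> Ef.
set c := \prod_(j < k | j != i) f j (z 0 j).
have E : (fun h => h^-1 *: ((tensor f \o shift z) (h *: delta_mx 0 i) - tensor f z)) =
    (fun h : R => (h^-1 *: ((f i \o shift (z 0 i)) (h *: 1) - f i (z 0 i))) * c).
  apply/funext => h /=.
  have -> : tensor f (h *: delta_mx 0 i + z) = f i (h + z 0 i) * c.
    rewrite /tensor (bigD1 i) //= !mxE !eqxx mulr1; congr (_ * _).
    by apply: eq_bigr => j ji; rewrite !mxE (negbTE ji) mulr0 add0r.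
  have -> : tensor f z = f i (z 0 i) * c by rewrite /tensor (bigD1 i).
  by rewrite -mulrBl /GRing.scale /= mulr1 mulrA.
have h : (fun h => h^-1 *: ((tensor f \o shift z) (h *: delta_mx 0 i) - tensor f z))
    @ 0^' --> tensor (fun j => if j == i then derive1 (f j) else f j) z.
  rewrite E /tensor (bigD1 i) //= eqxx.
  rewrite (eq_bigr (fun j => f j (z 0 j))) => [|j /negbTE ->//].
  apply: cvgMr_tmp; rewrite derive1E.
  exact: (elementary_derivable (Ef i)).
by apply: DeriveDef; [apply/cvg_ex; eexists; exact: h|exact: cvg_lim h].
Qed.

(** A partial derivative only differentiates one factor of a product of functions
of one variable each. *)
Lemma iter_partial_tensor f (s : seq 'I_k) : (forall i, elementary (f i)) ->
  exists2 g, (forall i, elementary (g i)) & iter_partial s (tensor f) = tensor g.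
Proof.
move=> Ef; elim: s => [|i s [g Eg /= ->]]; first by exists f.
exists (fun j => if j == i then derive1 (g j) else g j) => [j|].
  by case: ifP => // _; exact: elementary_derive1.
by apply/funext => z; have [_] := is_derive_tensor i z Eg.
Qed.

Lemma smooth_tensor f : (forall i, elementary (f i)) -> smooth (tensor f).
Proof.
move=> Ef s; have [g Eg ->] := iter_partial_tensor s Ef.
by split=> [|i z]; [exact: tensor_continuous|have [] := is_derive_tensor i z Eg].
Qed.

End tensor.

Section bump.
Context {R : realType}.
Implicit Types (a b t : R).

(** Positive exactly on ]a, b[; the parameter [m] steepens the bump, which tends to
the indicator of ]a, b[ as [m] tends to infinity. *)
Definition bump1 a b (m : R) t : R :=
  flat_exp 1 (m * (t - a)) * flat_exp 1 (m * (b - t)).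

Lemma elementary_bump1 a b m : elementary (bump1 a b m).
Proof.
rewrite /bump1 (_ : (fun t => _) = (fun t => flat_exp 1 (m * t + - (m * a)) *
   flat_exp 1 (- m * t + m * b))); last first.
  by apply/funext => t; congr (flat_exp 1 _ * flat_exp 1 _); ring.
by apply: elementary_mul; apply: (@elementary_affine _ _ _ (flat_exp 1));
  exact: elementary_flat.
Qed.

Lemma flat_exp1_ge0 t : 0 <= flat_exp 1 t.
Proof. by rewrite /flat_exp; case: ifP => // _; rewrite hornerC mul1r expR_ge0. Qed.

Lemma flat_exp1_le1 t : flat_exp 1 t <= 1.
Proof.
rewrite /flat_exp; case: ifP => // t0; rewrite hornerC mul1r -expR0 ler_expR.
by rewrite oppr_le0 invr_ge0 ltW.
Qed.

Lemma bump1_ge0 a b m t : 0 <= bump1 a b m t.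
Proof. by rewrite mulr_ge0 // flat_exp1_ge0. Qed.

Lemma bump1_le1 a b m t : bump1 a b m t <= 1.
Proof. by rewrite mulr_ile1 // ?flat_exp1_ge0 ?flat_exp1_le1. Qed.

Lemma bump1_out a b m t : 0 < m -> ~~ (a < t < b) -> bump1 a b m t = 0.
Proof.
move=> m0; rewrite negb_and -!leNgt => /orP[ta|bt]; rewrite /bump1 /flat_exp.
  by rewrite pmulr_rgt0 // subr_gt0 ltNge ta mul0r.
by rewrite (pmulr_rgt0 (b - t)) // subr_gt0 (ltNge t) bt mulr0.
Qed.

Lemma bump1_shift a b m t s : bump1 (a + s) (b + s) m t = bump1 a b m (t - s).
Proof. by rewrite /bump1; congr (flat_exp 1 _ * flat_exp 1 _); ring. Qed.

Lemma flat_exp1_cvg (t : R) : 0 < t ->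
  flat_exp 1 (m.+1%:R * t) @[m --> \oo] --> (1 : R).
Proof.
move=> t0.
rewrite (_ : (fun m => _) = (fun m : nat => expR (- (t^-1 * (m.+1%:R)^-1)))); last first.
  apply/funext => m; rewrite /flat_exp mulr_gt0 ?ltr0n // hornerC mul1r.
  by rewrite invfM mulrC.
have t0' : - (t^-1 / m.+1%:R) @[m --> \oo] --> (0 : R).
  rewrite -oppr0; apply: cvgN; rewrite -(mulr0 t^-1); apply: cvgMl_tmp.
  exact: cvg_harmonic.
rewrite -[X in _ --> X]expR0; exact: (continuous_cvg _ (@continuous_expR R 0) t0').
Qed.

Lemma bump1_cvg a b t :
  bump1 a b m.+1%:R t @[m --> \oo] --> ((a < t < b)%R%:R : R).
Proof.
have [/andP[at_ tb]|atb] := boolP (a < t < b).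
  have at0 : 0 < t - a by rewrite subr_gt0.
  have tb0 : 0 < b - t by rewrite subr_gt0.
  by have := cvgM (flat_exp1_cvg at0) (flat_exp1_cvg tb0); rewrite mulr1; exact.
rewrite (_ : (fun m => _) = cst 0); first exact: cvg_cst.
by apply/funext => m; rewrite bump1_out // ltr0n.
Qed.

Context {k : nat}.
Implicit Types (l u z v : 'rV[R]_k).

Definition box_bump l u (m : R) : 'rV[R]_k -> R := tensor (fun i => bump1 (l 0 i) (u 0 i) m).

Definition cbox l u : set 'rV[R]_k := [set z | forall i, l 0 i <= z 0 i <= u 0 i].

Lemma box_bump_ge0 l u m z : 0 <= box_bump l u m z.
Proof. by apply: prodr_ge0 => i _; exact: bump1_ge0. Qed.

Lemma box_bump_le1 l u m z : box_bump l u m z <= 1.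
Proof.
apply: (@le_trans _ _ (\prod_(i < k) (1 : R))); last by rewrite big1.
by apply: ler_prod => i _; rewrite bump1_ge0 bump1_le1.
Qed.

Lemma box_bump_out l u m z : 0 < m -> ~ obox l u z -> box_bump l u m z = 0.
Proof.
move=> m0 /existsNP[i /negP lzu].
by rewrite /box_bump /tensor (bigD1 i) //= bump1_out // mul0r.
Qed.

Lemma box_bump_cvg l u z : box_bump l u m.+1%:R z @[m --> \oo] --> (\1_(obox l u) z : R).
Proof.
have -> : \1_(obox l u) z = \prod_(i < k) ((l 0 i < z 0 i < u 0 i)%R%:R : R).
  rewrite indicE; have [zlu|zlu] := boolP (z \in obox l u).
    by rewrite big1 // => i _; move: zlu; rewrite inE => ->.
  have /existsNP[i /negP lzu] : ~ obox l u z by move=> h; rewrite mem_set in zlu.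
  by rewrite (bigD1 i) //= (negbTE lzu) mul0r.
apply: cvg_big => [|i _]; first by move=> p; exact: mul_continuous.
exact: bump1_cvg.
Qed.

Lemma box_bump_shift l u m z v : box_bump (l + v) (u + v) m z = box_bump l u m (z - v).
Proof.
by apply: eq_bigr => i _; rewrite !mxE bump1_shift.
Qed.

Lemma compact_cbox l u : compact (cbox l u).
Proof.
rewrite (_ : cbox l u = [set z | forall i, `[l 0 i, u 0 i]%classic (z ord0 i)]).
  by apply: (@rV_compact R k (fun i => `[l 0 i, u 0 i]%classic)) => i; exact: segment_compact.
by apply/seteqP; split=> z /= h i; have := h i; rewrite in_itv.
Qed.

Lemma closed_cbox l u : closed (cbox l u).
Proof. by apply: compact_closed; [exact: norm_hausdorff|exact: compact_cbox]. Qed.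

Lemma sub_obox_cbox l u : obox l u `<=` cbox l u.
Proof. by move=> z zlu i; have /andP[/ltW -> /ltW ->] := zlu i. Qed.

Lemma box_bump_test_function l u m (Omega : set 'rV[R]_k) : 0 < m ->
  cbox l u `<=` Omega -> test_function Omega (box_bump l u m).
Proof.
move=> m0 luO.
have sub : closure [set z | box_bump l u m z != 0] `<=` cbox l u.
  rewrite [X in _ `<=` X](closure_id _).1; last exact: closed_cbox.
  apply: closureS => z /= zn0; apply: sub_obox_cbox; apply: contrapT => nz.
  by move: zn0; rewrite box_bump_out ?eqxx.
split.
- by apply: smooth_tensor => i; exact: elementary_bump1.
- by apply: subclosed_compact sub; [exact: closed_closure|exact: compact_cbox].
- exact: subset_trans luO.
Qed.

End bump.

(** * Test functions along lines *)

Section test_functions.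
Context {R : realType} {k : nat}.
Implicit Types (phi : 'rV[R]_k -> R) (Omega : set 'rV[R]_k) (i : 'I_k).

Lemma test_function_partial_continuous Omega phi i :
  test_function Omega phi -> continuous (partial i phi).
Proof. by move=> [/(_ [:: i])[]]. Qed.

Lemma partial_eq0 (S : set 'rV[R]_k) phi i : closed S ->
  (forall z, ~ S z -> phi z = 0) -> forall z, ~ S z -> partial i phi z = 0.
Proof.
move=> cS phi0 z nSz.
rewrite /partial (@near_eq_derive _ _ _ _ (cst 0)) ?derive_cst //.
have : nbhs z (~` S) by apply: open_nbhs_nbhs; split => //; exact: closed_openC.
by apply: filterS => y; exact: phi0.
Qed.

Lemma test_function_partial_bounded Omega phi i : test_function Omega phi ->
  exists M : R, forall z, `|partial i phi z| <= M.
Proof.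
move=> tphi; have [_ cS _] := tphi.
set S := closure _ in cS.
have : compact (partial i phi @` S).
  apply: continuous_compact => //.
  by apply: continuous_subspaceT; exact: test_function_partial_continuous tphi.
move=> /compact_bounded[M [_ HM]].
exists (Num.max 0 (M + 1)) => z.
have [Sz|nSz] := pselect (S z).
  rewrite le_max; apply/orP; right; apply: HM; first by rewrite ltrDl.
  by exists z.
rewrite (partial_eq0 i (S := S)) ?normr0 ?le_max ?lexx //; first exact: closed_closure.
move=> y nSy; apply: contrapT => phiy; apply: nSy.
by apply: subset_closure => /=; apply/eqP.
Qed.

Lemma is_derive_line phi i z (s : R) : derivable phi (z + s *: delta_mx 0 i) (delta_mx 0 i) ->
  is_derive s (1 : R) (fun t : R => phi (z + t *: delta_mx 0 i))
    (partial i phi (z + s *: delta_mx 0 i)).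
Proof.
set e := delta_mx 0 i => dphi.
have E : (fun h => h^-1 *: (((fun t : R => phi (z + t *: e)) \o shift s) (h *: 1) -
      phi (z + s *: e))) =
    (fun h => h^-1 *: ((phi \o shift (z + s *: e)) (h *: e) - phi (z + s *: e))).
  apply/funext => h /=; congr (_ *: (phi _ - _)).
  by rewrite [_%:A]mulr1 scalerDl addrCA.
apply: DeriveDef; first by rewrite /derivable E.
by rewrite /derive E.
Qed.

Lemma smooth_line_FTC Omega phi i z (s : R) : test_function Omega phi -> 0 < s ->
  phi (z - s *: delta_mx 0 i) - phi z =
  - \int[lebesgue_measure]_(t in `[0, s]) partial i phi (z - t *: delta_mx 0 i).
Proof.
set e := delta_mx 0 i => tphi s0.
have [smphi _ _] := tphi.
have dF (t : R) : is_derive t (1 : R) (fun t : R => phi (z - t *: e)) (- partial i phi (z - t *: e)).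
  have h : is_derive (- t) (1 : R) (fun t : R => phi (z + t *: e)) (partial i phi (z + (- t) *: e)).
    by apply: is_derive_line; have [_] := smphi [::].
  have hN : is_derive t (1 : R) (fun t : R => - t) (- 1) by exact: is_deriveN.
  have := @is_derive1_comp _ (fun t : R => phi (z + t *: e)) (fun t : R => - t) _ _ _ h hN.
  rewrite mulrN1 scaleNr.
  congr (is_derive _ _ _ _).
  by apply/funext => t' /=; rewrite scaleNr.
have cP : continuous (fun t : R => partial i phi (z - t *: e)).
  move=> t; apply: (@continuous_comp _ _ _ (fun t : R => z - t *: e) (partial i phi)).
    apply: cvgB; first exact: cvg_cst.
    by apply: cvgZr_tmp; exact: cvg_id.
  exact: test_function_partial_continuous tphi _.
have cF : continuous (fun t : R => - partial i phi (z - t *: e)).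
  by move=> t; apply: cvgN; exact: cP.
have := @continuous_FTC2 R (fun t : R => - partial i phi (z - t *: e)) (fun t : R => phi (z - t *: e)) 0 s s0.
have cG : continuous (fun t : R => phi (z - t *: e)).
  by move=> t; apply: differentiable_continuous; apply/derivable1_diffP; have [] := dF t.
move=> /(_ _ _ _)/wrap[||t _|].
- exact: continuous_subspaceT.
- split=> [t _||]; first by have [] := dF t.
    by apply: cvg_at_right_filter; exact: cG.
  by apply: cvg_at_left_filter; exact: cG.
- by rewrite derive1E; have [] := dF t.
rewrite scale0r subr0 => h.
have mu0 : lebesgue_measure.-integrable `[0, s] (EFin \o (fun t : R => partial i phi (z - t *: e))).
  apply: continuous_compact_integrable; first exact: segment_compact.
  exact: continuous_subspaceT.
rewrite -EFinB in h; rewrite -[LHS]/(fine (_)%:E) -h.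
rewrite -mulN1r -RintegralZl //; congr fine.
by apply: eq_integral => t _; rewrite mulN1r.
Qed.

End test_functions.

(** * The fundamental lemma of the calculus of variations *)

Section fundamental_lemma.
Context {R : realType} {k : nat}.
Local Notation mu := (@lebesgue_rV R k).
Implicit Types (l u z : 'rV[R]_k) (w : 'rV[R]_k -> R).

Lemma measurable_box_bump l u (m : R) : measurable_fun setT (box_bump l u m).
Proof.
apply: continuous_measurable_mx; apply: tensor_continuous => i.
exact: elementary_bump1.
Qed.

(** Dominated convergence: the bumps are bounded by 1 and tend to the indicator of
the box. *)
Lemma integral_obox_eq0 l u w : mu.-integrable setT (EFin \o w) ->
  (forall m : nat, \int[mu]_z (w z * box_bump l u m.+1%:R z)%:E = 0)%E ->
  (\int[mu]_(z in obox l u) (w z)%:E = 0)%E.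
Proof.
move=> iw w0.
have mw : measurable_fun setT w by apply/measurable_EFinP; exact: measurable_int iw.
have mi : measurable_fun setT (\1_(obox l u) : 'rV[R]_k -> R).
  by apply: measurable_indic; exact: measurable_obox.
have h1 z : (w z * box_bump l u m.+1%:R z)%:E @[m --> \oo] --> (w z * \1_(obox l u) z)%:E.
  by apply: cvg_EFin; [exact: nearW|apply: cvgM; [exact: cvg_cst|exact: box_bump_cvg]].
have h2 m z : (`|(w z * box_bump l u m.+1%:R z)%:E| <= `|w z|%:E)%E.
  by rewrite lee_fin normrM ler_piMr // ger0_norm ?box_bump_ge0 // box_bump_le1.
have [_ _ h] := @dominated_convergence _ _ R mu setT measurableT
  (fun m z => (w z * box_bump l u m.+1%:R z)%:E) (fun z => (w z * \1_(obox l u) z)%:E)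
  (fun z => `|w z|%:E)
  (fun m => (measurable_EFinP _ _).2 (measurable_funM mw (measurable_box_bump l u _)))
  ((measurable_EFinP _ _).2 (measurable_funM mw mi))
  (aeW _ (fun z _ => h1 z)) (integrable_norm iw) (aeW _ (fun z m _ => h2 m z)).
rewrite integral_mkcond.
transitivity (\int[mu]_z (w z * \1_(obox l u) z)%:E)%E.
  apply: eq_integral => z _; rewrite patchE indicE.
  by case: ifP => _; rewrite ?mulr1 ?mulr0.
have h0 : (fun m : nat => \int[mu]_z (w z * box_bump l u m.+1%:R z)%:E)%E @ \oo --> 0%E.
  by rewrite (_ : (fun m => _) = cst 0%E); [exact: cvg_cst|exact/funext].
exact: (cvg_unique _ h h0).
Qed.

(** The integral of [w] vanishes on every box inside the given one.  Boxes generate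
the Borel sets and are stable under intersection, so by Dynkin's lemma the
integral of [w] vanishes on every Borel subset of the given box. *)
Lemma fundamental_lemma l0 u0 w : mu.-integrable setT (EFin \o w) ->
  (forall l u (m : nat), cbox l u `<=` cbox l0 u0 ->
    \int[mu]_z (w z * box_bump l u m.+1%:R z)%:E = 0)%E ->
  {ae mu, forall z, obox l0 u0 z -> w z = 0}.
Proof.
move=> iw w0.
have mB := measurable_obox l0 u0.
have int0 (A : set 'rV[R]_k) : measurable A ->
    (\int[mu]_(z in A `&` obox l0 u0) (w z)%:E = 0)%E.
  rewrite borel_obox; move: A; apply: (@dynkin_induction _ _ _
    (fun A => \int[mu]_(z in A `&` obox l0 u0) (w z)%:E = 0)%E borel_obox setI_obox).
  - rewrite setTI; apply: integral_obox_eq0 => // m; exact: w0.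
  - move=> _ [l [u ->]]; rewrite setI_oboxE.
    apply: integral_obox_eq0 => // m; apply: w0 => z zlu i.
    by have := zlu i; rewrite !mxE ge_max le_min => /andP[/andP[_ ->] /andP[_ ->]].
  - move=> S mS S0.
    have B0 : (\int[mu]_(z in obox l0 u0) (w z)%:E = 0)%E.
      by apply: integral_obox_eq0 => // m; exact: w0.
    rewrite -[RHS]B0 -[in RHS](setTI (obox l0 u0)) -(setUv S) setIUl.
    rewrite integral_setU ?S0 ?add0e //.
    + exact: measurableI.
    + by apply: measurableI => //; exact: measurableC.
    + by apply: measurable_funTS; exact: measurable_int iw.
    + by apply/disj_setPS => z [[Sz _] [nSz _]]; exact: nSz.
  - move=> F mF tF F0; rewrite setI_bigcupl integral_bigcup //.
    + by apply: eseries0 => n _ _; exact: F0.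
    + exact: trivIset_setIr.
    + by move=> n; apply: measurableI => //; exact: mF.
    + by apply: integrableS iw => //; apply: bigcupT_measurable => n; apply: measurableI => //; exact: mF.
have h := @integral_ae_eq _ _ R mu (obox l0 u0) mB (cst 0%E) (EFin \o w).
have {h} : ae_eq mu (obox l0 u0) (EFin \o w) (cst 0%E).
  apply: h => [||E EB mE].
  - by apply: integrableS iw.
  - exact: measurable_cst.
  - by rewrite integral0 -(setIidl EB) int0.
by apply: ae_imp => z /= h /h [].
Qed.

End fundamental_lemma.

(** * Integrals along segments *)

Section line_integrals.
Context {R : realType} {k : nat}.
Local Notation mu := (@lebesgue_rV R k).
Local Notation lam := (@lebesgue_measure R).
Implicit Types (g : 'rV[R]_k -> R) (v z : 'rV[R]_k) (D : set (measurableTypeR R)).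

Lemma integrable_measurable_real g : mu.-integrable setT (EFin \o g) ->
  measurable_fun setT g.
Proof. by move=> ig; apply/measurable_EFinP; exact: measurable_int ig. Qed.

(** By Tonelli's theorem and translation invariance this integral is the measure of
[D] times the L^1 norm of [g]. *)
Lemma line_integral_lty g v D : measurable D -> (lam D < +oo)%E ->
  mu.-integrable setT (EFin \o g) ->
  (\int[mu]_z \int[lam]_(s in D) `|(g (z + s *: v))%:E| < +oo)%E.
Proof.
move=> mD Doo ig; have mg := integrable_measurable_real ig.
rewrite (@tonelli_line R k v D (fun z => `|(g z)%:E|)%E) //.
  have [_ goo] := integrableP _ _ _ ig.
  by apply: lte_mul_pinfty => //; [exact: integral_ge0|rewrite ge0_fin_numE // integral_ge0].
by apply/measurable_EFinP; exact: measurableT_comp.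
Qed.

Lemma measurable_line_section g v z D : measurable_fun setT g ->
  measurable_fun D (fun s : measurableTypeR R => g (z + s *: v)).
Proof.
move=> mg; apply: measurable_funTS.
exact: (measurableT_comp (measurable_fun_line v mg) (pair1_measurable z)).
Qed.

Lemma measurable_line_abs_integral g v D : measurable D -> measurable_fun setT g ->
  measurable_fun setT (fun z => \int[lam]_(s in D) `|(g (z + s *: v))%:E|)%E.
Proof.
move=> mD mg.
apply: (@measurable_fun_integral_in _ _ _ _ _ lam D
  (fun p : 'rV[R]_k * measurableTypeR R => `|(g (p.1 + (p.2 : R) *: v)%R)%:E|%E)) => //.
by apply/measurable_EFinP; apply: measurableT_comp => //; exact: measurable_fun_line.
Qed.

Lemma ae_line_integrable g v D : measurable D -> (lam D < +oo)%E ->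
  mu.-integrable setT (EFin \o g) ->
  {ae mu, forall z, lam.-integrable D (fun s : R => (g (z + s *: v))%:E)}.
Proof.
move=> mD Doo ig; have mg := integrable_measurable_real ig.
have : mu.-integrable setT (fun z => \int[lam]_(s in D) `|(g (z + s *: v))%:E|)%E.
  apply/integrableP; split; first exact: measurable_line_abs_integral.
  under eq_integral do rewrite gee0_abs ?integral_ge0 //.
  exact: line_integral_lty.
move=> /(integrable_ae measurableT); apply: ae_imp => z /(_ I) zfin.
apply/integrableP; split; first by apply/measurable_EFinP; exact: measurable_line_section.
by move: zfin => /fin_numPlt/andP[_].
Qed.

Definition line_integral g v D z : R := \int[lam]_(s in D) g (z + s *: v).

Lemma measurable_line_integral g v D : measurable D -> measurable_fun setT g ->
  measurable_fun setT (line_integral g v D).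
Proof.
move=> mD mg; apply: measurableT_comp => //.
apply: (@measurable_fun_integral_in _ _ _ _ _ lam D
  (fun p : 'rV[R]_k * measurableTypeR R => (g (p.1 + (p.2 : R) *: v)%R)%:E)%E) => //.
by apply/measurable_EFinP; exact: measurable_fun_line.
Qed.

Lemma line_integral_abs_le g v D z : measurable D -> measurable_fun setT g ->
  (`|(line_integral g v D z)%:E| <= \int[lam]_(s in D) `|(g (z + s *: v))%:E|)%E.
Proof.
move=> mD mg; rewrite /line_integral /Rintegral.
have h : (`| \int[lam]_(s in D) (g (z + s *: v))%:E| <= \int[lam]_(s in D) `|(g (z + s *: v))%:E|)%E.
  by apply: le_abse_integral => //; apply/measurable_EFinP; exact: measurable_line_section.
case: (\int[lam]_(s in D) (g (z + s *: v))%:E)%E h => //= _; rewrite normr0; exact: integral_ge0.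
Qed.

Lemma integrable_line_integral g v D : measurable D -> (lam D < +oo)%E ->
  mu.-integrable setT (EFin \o g) ->
  mu.-integrable setT (EFin \o line_integral g v D).
Proof.
move=> mD Doo ig; have mg := integrable_measurable_real ig.
apply/integrableP; split.
  by apply/measurable_EFinP; exact: measurable_line_integral.
apply: le_lt_trans (line_integral_lty v mD Doo ig).
apply: ge0_le_integral => //.
- by apply: measurableT_comp => //; apply/measurable_EFinP; exact: measurable_line_integral.
- exact: measurable_line_abs_integral.
- by move=> z _; exact: line_integral_abs_le.
Qed.

End line_integrals.

(** * Increments of a Sobolev function *)

Section difference_formula.
Context {R : realType} {k : nat}.
Local Notation mu := (@lebesgue_rV R k).
Local Notation lam := (@lebesgue_measure R).
Implicit Types (z l : 'rV[R]_k).

Lemma lebesgue_measure_segment (s : R) : 0 <= s -> lam `[0, s] = s%:E.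
Proof.
rewrite le_eqVlt => /predU1P[<-|s0]; rewrite lebesgue_measure_itv /= lte_fin.
  by rewrite ltxx.
by rewrite s0 -EFinD subr0.
Qed.

Lemma integrable_mul_bounded d (T : measurableType d) (m : {measure set T -> \bar R})
    (f h : T -> R) (M : R) :
  m.-integrable setT (EFin \o f) -> measurable_fun setT h -> (forall x, `|h x| <= M) ->
  m.-integrable setT (fun x => (f x * h x)%:E).
Proof.
move=> If mh hM.
apply: (@le_integrable _ _ _ m setT measurableT _ (fun x => (M * f x)%:E)).
- apply/measurable_EFinP; apply: measurable_funM => //.
  by apply/measurable_EFinP; exact: measurable_int If.
- move=> x _; rewrite !abse_EFin lee_fin !normrM mulrC ler_wpM2r //.
  by apply: le_trans (hM x) _; exact: ler_norm.
- have := integrableZl measurableT M If; by under eq_fun do rewrite -EFinM.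
Qed.

Lemma le_iterated_integral (D : set (measurableTypeR R))
    (F G : 'rV[R]_k * measurableTypeR R -> \bar R) :
  measurable D -> measurable_fun setT F -> measurable_fun setT G ->
  (forall p, `|F p| <= `|G p|)%E ->
  (\int[mu]_z \int[lam]_(t in D) `|G (z, t)| < +oo)%E ->
  (\int[mu]_z \int[lam]_(t in D) `|F (z, t)| < +oo)%E.
Proof.
move=> mD mF mG FG; apply: le_lt_trans.
have mabs (H : 'rV[R]_k * measurableTypeR R -> \bar R) : measurable_fun setT H ->
    measurable_fun setT (fun z => \int[lam]_(t in D) `|H (z, t)|)%E.
  move=> mH; apply: (@measurable_fun_integral_in _ _ _ _ _ lam D (fun p => `|H p|)%E) => //.
  exact: measurableT_comp.
have msec (H : 'rV[R]_k * measurableTypeR R -> \bar R) z : measurable_fun setT H ->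
    measurable_fun D (fun t => `|H (z, t)|)%E.
  move=> mH; apply: measurable_funTS; apply: measurableT_comp => //.
  exact: (measurableT_comp mH (pair1_measurable z)).
apply: ge0_le_integral => //.
- by move=> z _; exact: integral_ge0.
- exact: mabs.
- exact: mabs.
- move=> z _; apply: ge0_le_integral => //; exact: msec.
Qed.

Variables (u g : 'rV[R]_k -> R) (i : 'I_k) (l3 u3 : 'rV[R]_k).
Hypothesis iu : mu.-integrable setT (EFin \o u).
Hypothesis ig : mu.-integrable setT (EFin \o g).
Hypothesis ug : forall l r (m : nat), cbox l r `<=` cbox l3 u3 ->
  (\int[mu]_z (- (u z * partial i (box_bump l r m.+1%:R) z))%:E =
   \int[mu]_z (g z * box_bump l r m.+1%:R z)%:E)%E.

Local Notation e := (delta_mx 0 i : 'rV[R]_k).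

Let measurable_u : measurable_fun setT u. Proof. exact: integrable_measurable_real iu. Qed.
Let measurable_g : measurable_fun setT g. Proof. exact: integrable_measurable_real ig. Qed.

Lemma partial_box_bump_shift l r (m : R) (t : R) z :
  partial i (box_bump (l + t *: e) (r + t *: e) m) z = partial i (box_bump l r m) (z - t *: e).
Proof.
rewrite /partial /derive (_ : (fun h => _) = (fun h : R => h^-1 *:
    ((box_bump l r m \o shift (z - t *: e)) (h *: e) - box_bump l r m (z - t *: e)))) //.
by apply/funext => h /=; rewrite !box_bump_shift addrA.
Qed.

Lemma cbox_shift (l r v z : 'rV[R]_k) : cbox (l + v) (r + v) z = cbox l r (z - v).
Proof.
by rewrite propeqE; split=> h j; have := h j; rewrite !mxE lerBrDr lerBlDr.
Qed.

(** The increment of the bump is an integral of its derivatives along a segment.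
Fubini's theorem brings the segment outside, the hypothesis [ug] is applied to
each translate of the bump, and Fubini's theorem brings the segment back inside. *)
Lemma bump_difference_integral l r (m : nat) (s : R) : 0 < s ->
  (forall t, 0 <= t <= s -> cbox (l + t *: e) (r + t *: e) `<=` cbox l3 u3) ->
  (\int[mu]_z (u z * (box_bump l r m.+1%:R (z - s *: e) - box_bump l r m.+1%:R z))%:E =
   \int[mu]_z (line_integral g e `[0%R, s] z * box_bump l r m.+1%:R z)%:E)%E.
Proof.
move=> s0 sub; set phi := box_bump l r m.+1%:R.
have tphi : test_function setT phi.
  by apply: box_bump_test_function => //; rewrite ltr0n.
have mD : measurable (`[0, s]%classic : set (measurableTypeR R)) by [].
have Doo : (lam `[0%R, s] < +oo)%E by rewrite lebesgue_measure_segment ?ltry // ltW.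
have [M phiM] := test_function_partial_bounded i tphi.
have mphi : measurable_fun setT phi := measurable_box_bump l r m.+1%:R.
have mdphi : measurable_fun setT (partial i phi).
  by apply: continuous_measurable_mx; exact: test_function_partial_continuous tphi.
pose F (p : 'rV[R]_k * measurableTypeR R) : \bar R :=
  (- (u p.1 * partial i phi (p.1 + (p.2 : R) *: (- e))))%:E.
pose G (p : 'rV[R]_k * measurableTypeR R) : \bar R :=
  (g (p.1 + (p.2 : R) *: e) * phi p.1)%:E.
have mF : measurable_fun setT F.
  apply/measurable_EFinP; apply: measurableT_comp => //; apply: measurable_funM.
    exact: (measurableT_comp measurable_u measurable_fst).
  exact: measurable_fun_line.
have mG : measurable_fun setT G.
  apply/measurable_EFinP; apply: measurable_funM; first exact: measurable_fun_line.
  exact: (measurableT_comp mphi measurable_fst).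
have iF z : lam.-integrable `[0%R, s] (EFin \o (fun t : R => partial i phi (z - t *: e))).
  apply: measurable_bounded_integrable => //.
    rewrite (_ : (fun t => _) = (fun t : measurableTypeR R =>
        partial i phi (z + (t : R) *: (- e)))); first exact: measurable_line_section.
    by apply/funext => t; rewrite scalerN.
  by exists M; split; [exact: num_real|move=> y My t _; exact: le_trans (phiM _) (ltW My)].
transitivity (\int[mu]_z \int[lam]_(t in `[0%R, s]) F (z, t))%E.
  apply: eq_integral => z _.
  rewrite (smooth_line_FTC i z tphi s0) mulrN -mulNr -RintegralZl //.
  rewrite /Rintegral fineK; last first.
    apply: integrable_fin_num => //.
    exact: (@integrableZl _ _ _ lam `[0%R, s]%classic mD (- u z) _ (iF z)).
  by apply: eq_integral => t _; rewrite /F /= scalerN mulNr.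
rewrite (fubini_in mD mF); last first.
  pose H (p : 'rV[R]_k * measurableTypeR R) : \bar R := (u p.1 * M)%:E.
  apply: (@le_iterated_integral _ F H) => //.
  - apply/measurable_EFinP; apply: measurable_funM => //.
    exact: (measurableT_comp measurable_u measurable_fst).
  - move=> p; rewrite /F /H !abse_EFin lee_fin normrN !normrM ler_wpM2l //.
    by apply: le_trans (phiM _) _; exact: ler_norm.
  rewrite (_ : (fun z => _) = (fun z => s%:E * `|(M * u z)%:E|)%E); last first.
    apply/funext => z; rewrite /H /= mulrC.
    rewrite (integral_cst lam mD `|(M * u z)%:E|%E) muleC.
    by congr (_ * _)%E; exact: lebesgue_measure_segment (ltW s0).
  have iMu : mu.-integrable setT (fun z => (M * u z)%:E).
    by have := integrableZl measurableT M iu; under eq_fun do rewrite -EFinM.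
  have [mMu Moo] := integrableP _ _ _ iMu.
  rewrite ge0_integralZl_EFin ?(ltW s0) //; last exact: measurableT_comp.
  by apply: lte_mul_pinfty => //; rewrite lee_fin ltW.
transitivity (\int[lam]_(t in `[0%R, s]) \int[mu]_z G (z, t))%E.
  apply: eq_integral => t; rewrite inE /= in_itv /= => t0s.
  transitivity (\int[mu]_z (g z * box_bump (l + t *: e) (r + t *: e) m.+1%:R z)%:E)%E.
    rewrite -ug; last exact: sub.
    by apply: eq_integral => z _; rewrite /F /= partial_box_bump_shift scalerN.
  rewrite -(@integral_shift R k (t *: e)).
    by apply: eq_integral => z _; rewrite /G /= box_bump_shift addrK.
  apply/measurable_EFinP; apply: measurable_funM => //; exact: measurable_box_bump.
rewrite -(fubini_in mD mG); last first.
  apply: (@le_iterated_integral _ G (fun p => (g (p.1 + (p.2 : R) *: e))%:E)) => //.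
  - by apply/measurable_EFinP; exact: measurable_fun_line.
  - move=> p; rewrite /G !abse_EFin lee_fin normrM ler_piMr //.
    by rewrite ger0_norm ?box_bump_ge0 ?box_bump_le1.
  exact: line_integral_lty.
apply: ae_eq_integral => //.
- exact: measurable_fun_integral_in.
- apply/measurable_EFinP; apply: measurable_funM => //; exact: measurable_line_integral.
- have := ae_line_integrable e mD Doo ig.
  apply: ae_imp => z iz _ /=; rewrite /G /line_integral mulrC -RintegralZl // /Rintegral fineK.
    by apply: eq_integral => t _; rewrite mulrC.
  apply: integrable_fin_num => //.
  exact: (@integrableZl _ _ _ lam `[0%R, s]%classic mD (phi z) _ iz).
Qed.

(** Tested against a bump, the increment of [u] becomes an increment of the bump,
hence by [bump_difference_integral] the line integral of [g]; the fundamental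
lemma removes the bump. *)
Lemma difference_formula l2 u2 (s : R) : 0 < s ->
  (forall t, 0 <= t <= s -> cbox (l2 + t *: e) (u2 + t *: e) `<=` cbox l3 u3) ->
  {ae mu, forall z, obox l2 u2 z ->
    u (z + s *: e) - u z = line_integral g e `[0%R, s] z}.
Proof.
move=> s0 sub.
have mD : measurable (`[0, s]%classic : set (measurableTypeR R)) by [].
have Doo : (lam `[0%R, s] < +oo)%E by rewrite lebesgue_measure_segment ?ltry // ltW.
have iI := integrable_line_integral e mD Doo ig.
have ius := integrable_shift (s *: e) iu.
pose w z := u (z + s *: e) - u z - line_integral g e `[0%R, s] z.
have iw : mu.-integrable setT (EFin \o w).
  have := integrableB measurableT (integrableB measurableT ius iu) iI.
  by apply: eq_integrable.
have : {ae mu, forall z, obox l2 u2 z -> w z = 0}.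
  apply: fundamental_lemma iw _ => l r m lr.
  set phi := box_bump l r m.+1%:R.
  have mphi : measurable_fun setT phi := measurable_box_bump l r m.+1%:R.
  have phi1 z : `|phi z| <= 1 by rewrite ger0_norm ?box_bump_ge0 ?box_bump_le1.
  have i1 := integrable_mul_bounded ius mphi phi1.
  have i2 := integrable_mul_bounded iu mphi phi1.
  have i3 := integrable_mul_bounded iI mphi phi1.
  have mphis : measurable_fun setT (fun z => phi (z - s *: e)).
    exact: measurable_fun_shift.
  have i1' := integrable_mul_bounded iu mphis (fun z => phi1 (z - s *: e)).
  have sublr t : 0 <= t <= s -> cbox (l + t *: e) (r + t *: e) `<=` cbox l3 u3.
    by move=> t0s; apply: subset_trans (sub t t0s) => z; rewrite !cbox_shift; exact: lr.
  have := bump_difference_integral m s0 sublr; rewrite -/phi => D.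
  have shiftE : (\int[mu]_z (u (z + s *: e) * phi z)%:E =
      \int[mu]_z (u z * phi (z - s *: e))%:E)%E.
    rewrite -(@integral_shift R k (s *: e) (fun z => (u z * phi (z - s *: e))%:E)) //.
      by apply: eq_integral => z _; rewrite addrK.
    exact: measurable_int i1'.
  transitivity (\int[mu]_z ((u (z + s *: e) * phi z)%:E - (u z * phi z)%:E -
     (line_integral g e `[0%R, s] z * phi z)%:E))%E.
    by apply: eq_integral => z _; rewrite -!EFinB /w !mulrBl.
  rewrite integralB //; last exact: integrableB.
  rewrite integralB // shiftE -integralB // -D.
  rewrite (eq_integral (fun z => (u z * (phi (z - s *: e) - phi z))%:E)); last first.
    by move=> z _; rewrite -EFinB mulrBr.
  rewrite subee // D; exact: integrable_fin_num.
by apply: ae_imp => z h zlu; have := h zlu; rewrite /w => /subr0_eq.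
Qed.

End difference_formula.

(** * Continuity of translations in L^1 *)

Section translation_continuity.
Context {R : realType}.
Local Notation lam := (@lebesgue_measure R).

Lemma measurable_addr (a : R) :
  measurable_fun setT (fun x : measurableTypeR R => (x + a : measurableTypeR R)).
Proof. exact: measurable_funD. Qed.

Lemma lebesgue_measure_shift (a : R) (A : set (measurableTypeR R)) :
  measurable A ->
  lebesgue_measure ((fun x : R => x + a) @^-1` A) = lebesgue_measure A.
Proof.
pose nu : {measure set (measurableTypeR R) -> \bar R} :=
  measure_function_pushforward__canonical__measure_function_Measure
   (@lebesgue_measure R) (measurable_addr a).
move=> mA; transitivity (nu A) => //.
apply/esym/lebesgue_measure_unique => // _ [[b c] _ <-].
rewrite /nu /= /pushforward.
rewrite (_ : _ @^-1` _ = `]b - a, c - a]%classic); last first.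
  by apply/seteqP; split=> x /=; rewrite !in_itv /= ltrBlDr lerBrDr.
by rewrite !lebesgue_measure_itv /= !lte_fin ltrD2r -!EFinB opprB addrA subrK.
Qed.

Lemma ge0_integral_shift_itv (a b c d t : R) (f : R -> \bar R) :
  measurable_fun setT (f : measurableTypeR R -> \bar R) -> (forall s, 0 <= f s)%E ->
  c <= a + t -> b + t <= d ->
  (\int[lam]_(s in `[a, b]) f (s + t)%R <= \int[lam]_(s in `[c, d]) f s)%E.
Proof.
move=> mf f0 cat btd.
apply: (@le_trans _ _ (\int[lam]_(s in `[(a + t)%R, (b + t)%R]) f s)%E); last first.
  apply: ge0_subset_integral => //; first exact: measurable_funTS.
  by move=> s /=; rewrite !in_itv /= => /andP[h1 h2]; rewrite (le_trans cat) // (le_trans h2).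
have := @ge0_integral_pushforward _ _ (measurableTypeR R) (measurableTypeR R) R _
  (measurable_addr t) lam `[(a + t)%R, (b + t)%R] f (measurable_itv _) (measurable_funTS mf).
rewrite (_ : _ @^-1` _ = `[a, b]%classic); last first.
  by apply/seteqP; split=> s /=; rewrite !in_itv /= !lerD2r.
move=> <-; last by move=> s _.
rewrite le_eqVlt; apply/orP; left; apply/eqP; apply/esym.
apply: eq_measure_integral => [|mphi A mA _]; first exact: measurable_addr.
by apply/esym; exact: lebesgue_measure_shift.
Qed.

Lemma ge0_cvg0 (u : nat -> \bar R) : (forall m, 0 <= u m)%E ->
  (forall eps : R, 0 < eps -> \forall m \near \oo, (u m <= eps%:E)%E) ->
  u @ \oo --> 0%E.
Proof.
move=> u0 ueps; apply/fine_cvgP; split.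
  have := ueps _ ltr01; apply: filterS => m um1.
  by rewrite ge0_fin_numE // (le_lt_trans um1) // ltry.
apply/cvgrPdist_le => eps e0; have := ueps _ e0; apply: filterS => m um.
rewrite sub0r normrN /= ger0_norm ?fine_ge0 //.
by have := fine_le _ _ um; rewrite /=; apply => //; rewrite ge0_fin_numE // (le_lt_trans um) ?ltry.
Qed.

Lemma continuous_translation_cvg (h : R -> R) (t : nat -> R) : continuous h ->
  (forall m, 0 <= t m <= 1) -> t @ \oo --> (0 : R) ->
  (\int[lam]_(s in `[0%R, 1%R]) `|(h (s + t m) - h s)%:E| @[m --> \oo] --> 0)%E.
Proof.
move=> ch t01 t0.
have : compact (h @` `[0, 2]%classic).
  by apply: continuous_compact; [exact: continuous_subspaceT|exact: segment_compact].
move=> /compact_bounded[M [_ HM]].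
have hM s : 0 <= s <= 2 -> `|h s| <= M + 1.
  by move=> s02; apply: HM; [rewrite ltrDl|exists s => //=; rewrite in_itv].
have mh (c : R) : measurable_fun setT (fun s : measurableTypeR R => (h (s + c) - h s)%:E).
  apply/measurable_EFinP; apply: measurable_funB; last exact: continuous_measurable_fun.
  exact: (measurableT_comp (continuous_measurable_fun ch) (measurable_addr c)).
have mD : measurable (`[0, 1]%classic : set (measurableTypeR R)) by [].
have h1 m : measurable_fun (`[0, 1]%classic : set (measurableTypeR R))
    (fun s : R => `|(h (s + t m) - h s)%:E|%E).
  by apply: measurable_funTS; apply: measurableT_comp => //; exact: mh.
have h2 s : `|(h (s + t m) - h s)%:E|%E @[m --> \oo] --> 0%E.
  have hs : h (s + t m) @[m --> \oo] --> h s.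
    have st : s + t m @[m --> \oo] --> s.
      by rewrite -[X in _ --> X]addr0; apply: cvgD => //; exact: cvg_cst.
    exact: (continuous_cvg _ (ch s) st).
  apply: cvg_EFin; first exact: nearW.
  rewrite -(normr0 R); apply: cvg_norm; rewrite -(subrr (h s)).
  by apply: cvgB => //; exact: cvg_cst.
have h3 : lam.-integrable (`[0, 1]%classic : set (measurableTypeR R))
    (EFin \o cst (M + 1 + (M + 1))).
  have Doo : (lam `[0%R, 1%R] < +oo)%E by rewrite lebesgue_measure_segment ?ltry.
  apply: measurable_bounded_integrable; [exact: mD|exact: Doo|exact: measurable_cst|].
  exists (M + 1 + (M + 1)); split; first exact: num_real.
  have M0 : 0 <= M + 1 by apply: le_trans (hM 0 _); rewrite ?lexx ?ler0n.
  by move=> y My s _ /=; rewrite (le_trans _ (ltW My)) // ger0_norm // addr_ge0.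
have h4 s m : `[0, 1]%classic s -> (`| `|(h (s + t m) - h s)%:E| | <= (M + 1 + (M + 1))%:E)%E.
  rewrite /= in_itv /= => /andP[s0 s1]; have /andP[tm0 tm1] := t01 m.
  rewrite lee_fin normr_id; apply: le_trans (ler_normB _ _) _.
  by apply: lerD; apply: hM; lra.
have /= [_ _] := @dominated_convergence _ (measurableTypeR R) R lam `[0, 1]%classic mD
  (fun m s => `|(h (s + t m) - h s)%:E|%E) (cst 0%E) (EFin \o cst (M + 1 + (M + 1))) h1
  (measurable_cst _) ltac:(by apply: aeW => s _; exact: h2) h3
  ltac:(by apply: aeW => s m; exact: h4).
by rewrite integral0.
Qed.


(** Approximation in L^1 by continuous functions.  The interval [0, 2] leaves room
for the translates of [0, 1]. *)
Lemma translation_cvg_1D (f : R -> R) (t : nat -> R) :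
  measurable_fun setT (f : measurableTypeR R -> R) ->
  lam.-integrable `[0, 2] (EFin \o f) ->
  (forall m, 0 <= t m <= 1) -> t @ \oo --> (0 : R) ->
  (\int[lam]_(s in `[0%R, 1%R]) `|(f (s + t m) - f s)%:E| @[m --> \oo] --> 0)%E.
Proof.
move=> mf If t01 t0.
have Efin : (lam `[0%R, 2%R] < +oo)%E by rewrite lebesgue_measure_segment ?ltry.
have [g_ [cg Ig gf]] := approximation_continuous_integrable (measurable_itv `[0, 2]) Efin If.
apply: ge0_cvg0 => [m|eps e0]; first exact: integral_ge0.
have [n gn] : exists n, (\int[lam]_(s in `[0%R, 2%R]) `|(f s - g_ n s)%:E| <= (eps / 4)%:E)%E.
  have /fine_cvgP[gfin /cvgrPdist_le/(_ (eps / 4))] := gf.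
  rewrite divr_gt0 // => /(_ isT) gle.
  have [n _ /(_ n (leqnn n)) [nfin nle]] := filterI gfin gle.
  exists n; rewrite -(fineK nfin) lee_fin.
  by move: nle; rewrite sub0r normrN /= ger0_norm // fine_ge0 // integral_ge0.
have cvg2 := continuous_translation_cvg (cg n) t01 t0.
have /fine_cvgP[kfin /cvgrPdist_le/(_ (eps / 2))] := cvg2.
rewrite divr_gt0 // => /(_ isT) kle.
have mgn : measurable_fun setT (g_ n : measurableTypeR R -> R) by exact: continuous_measurable_fun.
apply: filterS (filterI kfin kle) => m [mfin mle].
have {}mle : (\int[lam]_(s in `[0%R, 1%R]) `|(g_ n (s + t m) - g_ n s)%:E| <= (eps / 2)%:E)%E.
  rewrite -(fineK mfin) lee_fin.
  by move: mle; rewrite sub0r normrN /= ger0_norm // fine_ge0 // integral_ge0.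
have /andP[tm0 tm1] := t01 m.
pose d s := `|(f s - g_ n s)%:E|%E.
have md : measurable_fun setT (d : measurableTypeR R -> \bar R).
  by apply: measurableT_comp => //; apply/measurable_EFinP; exact: measurable_funB.
have mdt : measurable_fun setT (fun s : measurableTypeR R => d (s + t m)).
  exact: (measurableT_comp md (measurable_addr (t m))).
have mgg : measurable_fun setT (fun s : measurableTypeR R => `|(g_ n (s + t m) - g_ n s)%:E|%E).
  apply: measurableT_comp => //; apply/measurable_EFinP; apply: measurable_funB => //.
  exact: (measurableT_comp mgn (measurable_addr (t m))).
have d1 : (\int[lam]_(s in `[0%R, 1%R]) d (s + t m)%R <= (eps / 4)%:E)%E.
  apply: le_trans gn; apply: ge0_integral_shift_itv;
    [exact: md|by move=> s; exact: abse_ge0|by rewrite add0r|by rewrite -[leRHS]/(1 + 1) lerD2l].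
have d2 : (\int[lam]_(s in `[0%R, 1%R]) d s <= (eps / 4)%:E)%E.
  apply: le_trans gn; apply: ge0_subset_integral; [by []|by []|exact: measurable_funTS
    |by move=> s _; exact: abse_ge0|].
  by move=> s /=; rewrite !in_itv /= => /andP[-> s1]; rewrite (le_trans s1) // ler1n.
apply: (@le_trans _ _ (\int[lam]_(s in `[0%R, 1%R])
    (d (s + t m)%R + `|(g_ n (s + t m) - g_ n s)%:E| + d s))%E).
  apply: ge0_le_integral => //.
  - apply: measurable_funTS; apply: measurableT_comp => //; apply/measurable_EFinP.
    by apply: measurable_funB => //; exact: (measurableT_comp mf (measurable_addr (t m))).
  - by apply: measurable_funTS; apply: emeasurable_funD => //; exact: emeasurable_funD.
  - move=> s _; rewrite /d !abse_EFin -!EFinD lee_fin.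
    rewrite (distrC (f s)).
    have -> : f (s + t m) - f s = (f (s + t m) - g_ n (s + t m)) +
      (g_ n (s + t m) - g_ n s) + (g_ n s - f s) by ring.
    by apply: le_trans (ler_normD _ _) _; rewrite lerD2r ler_normD.
have d0 s : (0 <= d s)%E by exact: abse_ge0.
rewrite ge0_integralD; [|by []|by move=> s _; rewrite adde_ge0 // ?abse_ge0
  |by apply: measurable_funTS; exact: emeasurable_funD|by move=> s _; exact: d0
  |exact: measurable_funTS].
rewrite ge0_integralD; [|by []|by move=> s _; exact: d0|exact: measurable_funTS
  |by move=> s _; exact: abse_ge0|exact: measurable_funTS].
have -> : eps%:E = ((eps / 4)%:E + (eps / 2)%:E + (eps / 4)%:E)%E.
  by rewrite -!EFinD; congr EFin; field.
by apply: leeD => //; exact: leeD.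
Qed.


End translation_continuity.

Section translation_continuity_rV.
Context {R : realType} {k : nat}.
Local Notation mu := (@lebesgue_rV R k).
Local Notation lam := (@lebesgue_measure R).
Implicit Types (g : 'rV[R]_k -> R) (v z : 'rV[R]_k).

(** The modulus of continuity of translations in L^1. *)
Definition translation_defect g v (t : R) : \bar R :=
  (\int[mu]_z `|(g (z + t *: v) - g z)%:E|)%E.

Lemma measurable_translation_difference g v (t : R) : measurable_fun setT g ->
  measurable_fun setT (fun z => `|(g (z + t *: v) - g z)%:E|%E).
Proof.
move=> mg; apply: measurableT_comp => //; apply/measurable_EFinP.
by apply: measurable_funB => //; exact: measurable_fun_shift.
Qed.

(** By translation invariance the defect does not change when z is replaced by
z + s v, and it may be averaged over s in [0, 1].  It is then the integral over
z of one-dimensional defects along lines, which tend to 0 and are dominated by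
twice the integral of |g| over a segment. *)
Lemma translation_defect_cvg g v (t : nat -> R) : mu.-integrable setT (EFin \o g) ->
  (forall m, 0 <= t m <= 1) -> t @ \oo --> (0 : R) ->
  translation_defect g v (t m) @[m --> \oo] --> 0%E.
Proof.
move=> ig t01 t0; have mg := integrable_measurable_real ig.
pose D1 : set (measurableTypeR R) := `[0, 1]%classic.
pose D2 : set (measurableTypeR R) := `[0, 2]%classic.
have mD1 : measurable D1 by exact: measurable_itv.
have mD2 : measurable D2 by exact: measurable_itv.
have D2oo : (lam D2 < +oo)%E.
  have : (lam `[0%R, 2%R] < +oo)%E by rewrite lebesgue_measure_segment ?ltry.
  exact.
pose F m z := (\int[lam]_(s in D1) `|(g (z + s *: v + t m *: v) - g (z + s *: v))%:E|)%E.
pose H z := (\int[lam]_(s in D2) `|(g (z + s *: v))%:E|)%E.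
have defectE m : translation_defect g v (t m) = (\int[mu]_z F m z)%E.
  rewrite /F (tonelli_line v mD1 (measurable_translation_difference v (t m) mg)) //.
  have -> : lam D1 = 1%E by exact: lebesgue_measure_segment ler01.
  by rewrite mule1.
rewrite (_ : (fun m => _) = (fun m => \int[mu]_z F m z)%E); last exact/funext.
have mF m : measurable_fun setT (F m).
  rewrite /F; apply: (@measurable_fun_integral_in _ _ _ _ _ lam D1
    (fun p : 'rV[R]_k * measurableTypeR R => `|(g (p.1 + (p.2 : R) *: v + t m *: v) - g (p.1 + (p.2 : R) *: v))%:E|%E)) => //.
  exact: (measurable_fun_line v (measurable_translation_difference v (t m) mg)).
have iH : mu.-integrable setT H.
  apply/integrableP; split; first exact: measurable_line_abs_integral.
  under eq_integral do rewrite gee0_abs ?integral_ge0 //.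
  exact: line_integral_lty.
have sec z (c : R) : measurable_fun setT (fun s : measurableTypeR R => g (z + (s + c) *: v)).
  exact: (measurableT_comp (measurable_line_section v z (D := setT) mg) (measurable_addr c)).
have sec0 z : measurable_fun setT (fun s : measurableTypeR R => g (z + s *: v)).
  exact: measurable_line_section.
have Fcvg : {ae mu, forall z, setT z -> F m z @[m --> \oo] --> 0%E}.
  have := ae_line_integrable v mD2 D2oo ig; apply: ae_imp => z iz _.
  have := translation_cvg_1D (sec0 z) iz t01 t0; rewrite /F.
  by under [X in X @ _ --> _ -> _]eq_fun do under eq_integral do rewrite scalerDl addrA.
have msec z (c : R) : measurable_fun setT (fun s : measurableTypeR R => `|(g (z + (s + c) *: v))%:E|%E).
  by apply: measurableT_comp => //; apply/measurable_EFinP.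
have msec0 z : measurable_fun setT (fun s : measurableTypeR R => `|(g (z + s *: v))%:E|%E).
  by apply: measurableT_comp => //; apply/measurable_EFinP.
have FH m z : (`|F m z| <= H z + H z)%E.
  rewrite gee0_abs ?integral_ge0 //.
  have /andP[tm0 tm1] := t01 m.
  apply: (@le_trans _ _ (\int[lam]_(s in D1)
     (`|(g (z + (s + t m) *: v))%:E| + `|(g (z + s *: v))%:E|))%E).
    apply: ge0_le_integral => //.
    - apply: measurable_funTS; apply: measurableT_comp => //; apply/measurable_EFinP.
      apply: measurable_funB => //.
      apply: (eq_measurable_fun (fun s : measurableTypeR R => g (z + (s + t m) *: v))) => //.
      by move=> s _; rewrite scalerDl addrA.
    - by apply: measurable_funTS; exact: emeasurable_funD.
    - by move=> s _; rewrite !abse_EFin -EFinD lee_fin scalerDl addrA ler_normB.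
  rewrite ge0_integralD //; last 2 first.
  - exact: measurable_funTS.
  - exact: measurable_funTS.
  apply: leeD.
    apply: (@ge0_integral_shift_itv _ 0 1 0 2 (t m) (fun s => `|(g (z + s *: v))%:E|%E)).
    + exact: msec0.
    + by move=> s; exact: abse_ge0.
    + by rewrite add0r.
    + by rewrite -[leRHS]/(1 + 1) lerD2l.
  apply: ge0_subset_integral => //; first exact: measurable_funTS.
  by move=> s; rewrite /D1 /D2 /= !in_itv /= => /andP[-> s1]; rewrite (le_trans s1) // ler1n.
have [_ _] := @dominated_convergence _ _ R mu setT measurableT F (cst 0%E) (H \+ H)%E
  mF (measurable_cst _) Fcvg (integrableD measurableT iH iH)
  ltac:(by apply: aeW => z m _; exact: FH).
by rewrite integral0.
Qed.

Lemma translation_defect_small g v (eps : R) : mu.-integrable setT (EFin \o g) ->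
  0 < eps -> exists2 d : R, 0 < d &
    forall t, 0 <= t <= d -> (translation_defect g v t <= eps%:E)%E.
Proof.
move=> ig e0; apply: contrapT => nd.
have /choice[t tP] : forall m : nat, exists t : R,
    0 <= t <= m.+1%:R^-1 /\ ~~ (translation_defect g v t <= eps%:E)%E.
  move=> m; apply: contrapT => nt; apply: nd; exists m.+1%:R^-1; first by rewrite invr_gt0.
  move=> t tm; apply: contrapT => /negP nle; apply: nt; exists t; split=> //.
have t01 m : 0 <= t m <= 1.
  have [/andP[-> tm] _] := tP m; rewrite (le_trans tm) // invf_le1 // ler1n //.
have t0 : t @ \oo --> (0 : R).
  apply: (@squeeze_cvgr _ _ _ _ (cst 0) harmonic); last exact: cvg_harmonic.
    by apply: nearW => m; have [/andP[-> tm] _] := tP m.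
  exact: cvg_cst.
have /fine_cvgP[dfin /cvgrPdist_le/(_ eps e0) dle] := translation_defect_cvg v ig t01 t0.
have [m _ /(_ m (leqnn m)) [mfin mle]] := filterI dfin dle.
have [_] := tP m; rewrite -(fineK mfin) lee_fin.
move: mle; rewrite sub0r normrN /= ger0_norm ?fine_ge0 ?integral_ge0 //.
by move=> -> .
Qed.

End translation_continuity_rV.

(** * The form x dy - y dx along one segment *)

Section real_integrable.
Context (R : realType) d (T : measurableType d) (m : {measure set T -> \bar R}).
Implicit Types (D : set T) (f g : T -> R).

Lemma integrable_subR D f g : measurable D -> m.-integrable D (EFin \o f) ->
  m.-integrable D (EFin \o g) -> m.-integrable D (EFin \o (fun x => f x - g x)).
Proof. by move=> mD If Ig; apply: eq_integrable (integrableB mD If Ig). Qed.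

Lemma integrable_addR D f g : measurable D -> m.-integrable D (EFin \o f) ->
  m.-integrable D (EFin \o g) -> m.-integrable D (EFin \o (fun x => f x + g x)).
Proof. by move=> mD If Ig; apply: eq_integrable (integrableD mD If Ig). Qed.

Lemma integrable_scaleR D f (c : R) : measurable D -> m.-integrable D (EFin \o f) ->
  m.-integrable D (EFin \o (fun x => c * f x)).
Proof. by move=> mD If; apply: eq_integrable (integrableZl mD c If). Qed.

Lemma integrable_sumR (I : Type) (r : seq I) D (f : I -> T -> R) : measurable D ->
  (forall i, m.-integrable D (EFin \o f i)) ->
  m.-integrable D (EFin \o (fun x => \sum_(i <- r) f i x)).
Proof.
move=> mD If; elim: r => [|i r IHr].
  by apply: eq_integrable (integrable0 m D) => // x _; rewrite /= big_nil.
by apply: eq_integrable (integrable_addR mD (If i) IHr) => // x _; rewrite /= big_cons.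
Qed.

Lemma Rintegral_sum (I : Type) (r : seq I) D (f : I -> T -> R) : measurable D ->
  (forall i, m.-integrable D (EFin \o f i)) ->
  \int[m]_(x in D) (\sum_(i <- r) f i x) = \sum_(i <- r) \int[m]_(x in D) f i x.
Proof.
move=> mD If; elim: r => [|i r IHr].
  rewrite big_nil; under eq_Rintegral do rewrite big_nil.
  by rewrite /Rintegral integral0.
rewrite big_cons -IHr -RintegralD //; last exact: integrable_sumR.
by under eq_Rintegral do rewrite big_cons.
Qed.

Lemma ae_eq_Rintegral D f g : measurable D -> measurable_fun D f -> measurable_fun D g ->
  {ae m, forall x, D x -> f x = g x} -> \int[m]_(x in D) f x = \int[m]_(x in D) g x.
Proof.
move=> mD mf mg fg; rewrite /Rintegral; congr fine; apply: ae_eq_integral => //.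
- exact/measurable_EFinP.
- exact/measurable_EFinP.
- by apply: ae_imp fg => x fg Dx; rewrite /= fg.
Qed.
End real_integrable.

Section edge.
Context {R : realType}.
Local Notation lam := (@lebesgue_measure R).
Variables (h : R) (h0 : 0 < h).
Local Notation D := (`[0, h]%classic : set (measurableTypeR R)).
Implicit Types (f g : R -> R) (a b c : R).

Lemma segment_fin (s : R) : 0 <= s -> fine (lam `[0, s]) = s.
Proof. by move=> s0; rewrite lebesgue_measure_segment. Qed.

Lemma integrable_segment_cst c : lam.-integrable D (EFin \o cst c).
Proof.
have Doo : (lam `[0%R, h] < +oo)%E by rewrite lebesgue_measure_segment ?ltry // ltW.
apply: measurable_bounded_integrable; [by []|exact: Doo|exact: measurable_cst|].
exists `|c|; split; first exact: num_real.
by move=> y cy s _ /=; exact: ltW.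
Qed.

Definition running_integral a g (s : R) : R := a + \int[lam]_(t in `[0, s]) g t.

Section one_function.
Variables (g : R -> R) (ig : lam.-integrable D (EFin \o g)).

Lemma integrable_abs_sub c : lam.-integrable D (EFin \o (fun s => `|g s - c|)).
Proof.
have igc : lam.-integrable D (EFin \o (fun s => g s - c)).
  by apply: integrable_subR => //; exact: integrable_segment_cst.
exact: (integrable_norm igc).
Qed.

Lemma running_integral_approx a c (s : R) : s \in D ->
  `|running_integral a g s - (a + c * s)| <= \int[lam]_(t in D) `|g t - c|.
Proof.
rewrite inE /= in_itv /= => /andP[s0 sh].
have sub : `[0, s]%classic `<=` D.
  by move=> t /=; rewrite !in_itv /= => /andP[-> ts]; exact: le_trans sh.
have igs : lam.-integrable `[0, s] (EFin \o g) by apply: integrableS ig.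
have ics : lam.-integrable `[0, s] (EFin \o cst c).
  by apply: integrableS (integrable_segment_cst c).
have -> : running_integral a g s - (a + c * s) = \int[lam]_(t in `[0, s]) (g t - c).
  rewrite RintegralB // Rintegral_cst // segment_fin // /running_integral.
  by rewrite opprD addrACA subrr add0r.
have igc : lam.-integrable `[0, s] (EFin \o (fun t => g t - c)) by exact: integrable_subR.
apply: le_trans (le_normr_Rintegral _ igc) _ => //.
rewrite /Rintegral fine_le //.
- by apply: integrable_fin_num => //; exact: integrable_norm.
- by apply: integrable_fin_num => //; exact: integrable_abs_sub.
- apply: ge0_subset_integral => //.
  by apply: measurable_int (integrable_abs_sub c).
Qed.

Lemma running_integral_measurable a : measurable_fun D (running_integral a g).
Proof.
apply: measurable_funD => //; apply: subspace_continuous_measurable_fun => //.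
exact: parameterized_integral_continuous (ltW h0) ig.
Qed.

Lemma running_integral_bounded a : [bounded running_integral a g s | s in D].
Proof.
exists (`|a| + \int[lam]_(t in D) `|g t - 0|); split; first exact: num_real.
move=> y hy s sD; apply: le_trans (ltW hy) => /=.
have := running_integral_approx a 0 (mem_set sD); rewrite mul0r addr0 => ?.
by rewrite -lerBlDl; apply: le_trans (lerB_dist _ _) _.
Qed.

End one_function.

Variables (g g' : R -> R).
Hypothesis ig : lam.-integrable D (EFin \o g).
Hypothesis ig' : lam.-integrable D (EFin \o g').

Lemma integrable_running_mul a :
  lam.-integrable D (EFin \o (fun s => running_integral a g s * g' s)).
Proof.
exact: (@integrableMr _ (measurableTypeR R) R lam D (measurable_itv _)
  (running_integral a g) (EFin \o g') (running_integral_measurable ig a)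
  (running_integral_bounded ig a) ig').
Qed.
End edge.

Section edge_estimate.
Context {R : realType}.
Local Notation lam := (@lebesgue_measure R).
Variables (h eta : R) (g g' : R -> R) (a a' c c' : R).
Local Notation D := (`[0, h]%classic : set (measurableTypeR R)).
Hypotheses (h0 : 0 < h) (eta0 : 0 <= eta).
Hypothesis ig : lam.-integrable D (EFin \o g).
Hypothesis ig' : lam.-integrable D (EFin \o g').
Hypothesis gc : \int[lam]_(s in D) `|g s - c| <= h * eta.
Hypothesis gc' : \int[lam]_(s in D) `|g' s - c'| <= h * eta.

Let w s := running_integral a g s * g' s - running_integral a' g' s * g s.

(** Write g = c + error and g' = c' + error.  The terms (c s) c' and (c' s) c of the
integrand cancel, so that of the linear approximation only the contribution
h (a c' - a' c) of the starting point remains; everything else contains an error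
as a factor. *)
Lemma edge_estimate :
  `|\int[lam]_(s in D) w s - h * (a * c' - a' * c)| <=
  h * eta * (`|a| + `|a'| + h * (`|c| + `|c'|) *+ 2 + h * eta *+ 2).
Proof.
have mD : measurable D by exact: measurable_itv.
have iw : lam.-integrable D (EFin \o w).
  by apply: integrable_subR => //; exact: integrable_running_mul.
have hK : h * (a * c' - a' * c) = \int[lam]_(s in D) (cst (a * c' - a' * c) s).
  by rewrite Rintegral_cst // segment_fin ?(ltW h0) // mulrC.
have iK := integrable_segment_cst h0 (a * c' - a' * c).
have iwK : lam.-integrable D (EFin \o (fun s => w s - cst (a * c' - a' * c) s)).
  exact: integrable_subR.
rewrite hK -RintegralB //; apply: le_trans (le_normr_Rintegral mD iwK) _.
pose M := `|a| + h * `|c| + h * eta.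
pose M' := `|a'| + h * `|c'| + h * eta.
pose K := h * eta * (`|c| + `|c'|).
pose B s := (M * `|g' s - c'| + M' * `|g s - c|) + cst K s.
have iB1 : lam.-integrable D (EFin \o (fun s => M * `|g' s - c'|)).
  by apply: integrable_scaleR => //; exact: integrable_abs_sub.
have iB2 : lam.-integrable D (EFin \o (fun s => M' * `|g s - c|)).
  by apply: integrable_scaleR => //; exact: integrable_abs_sub.
have iB12 : lam.-integrable D (EFin \o (fun s => M * `|g' s - c'| + M' * `|g s - c|)).
  exact: integrable_addR.
have iB : lam.-integrable D (EFin \o B).
  by apply: integrable_addR => //; exact: integrable_segment_cst.
have M0 : 0 <= M by rewrite !addr_ge0 // mulr_ge0 // ltW.
have M'0 : 0 <= M' by rewrite !addr_ge0 // mulr_ge0 // ltW.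
apply: (@le_trans _ _ (\int[lam]_(s in D) B s)).
  apply: le_Rintegral => //; first exact: integrable_norm.
  move=> s sD.
  have Es := le_trans (running_integral_approx h0 ig a c (mem_set sD)) gc.
  have Es' := le_trans (running_integral_approx h0 ig' a' c' (mem_set sD)) gc'.
  have /andP[s0 sh] : 0 <= s <= h by move: sD; rewrite /= in_itv.
  rewrite /w /B /cst.
  set X := running_integral a g s in Es *; set X' := running_integral a' g' s in Es' *.
  set E := X - (a + c * s) in Es *; set E' := X' - (a' + c' * s) in Es' *.
  have XE : X = a + c * s + E by rewrite /E addrC subrK.
  have XE' : X' = a' + c' * s + E' by rewrite /E' addrC subrK.
  have -> : X * g' s - X' * g s - (a * c' - a' * c) =
    X * (g' s - c') - X' * (g s - c) + (E * c' - E' * c) by rewrite XE XE'; ring.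
  have bX : `|X| <= M.
    rewrite XE; apply: le_trans (ler_normD _ _) _; apply: lerD => //.
    apply: le_trans (ler_normD _ _) _; apply: lerD => //.
    by rewrite normrM mulrC ler_wpM2r // ger0_norm.
  have bX' : `|X'| <= M'.
    rewrite XE'; apply: le_trans (ler_normD _ _) _; apply: lerD => //.
    apply: le_trans (ler_normD _ _) _; apply: lerD => //.
    by rewrite normrM mulrC ler_wpM2r // ger0_norm.
  apply: le_trans (ler_normD _ _) _; apply: lerD.
    apply: le_trans (ler_normB _ _) _; rewrite !normrM.
    by apply: lerD; exact: ler_wpM2r.
  apply: le_trans (ler_normB _ _) _; rewrite !normrM /K mulrDr addrC.
  by apply: lerD; exact: ler_wpM2r.
rewrite /B RintegralD //; last exact: integrable_segment_cst.
rewrite Rintegral_cst // segment_fin ?(ltW h0) //.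
rewrite RintegralD // !RintegralZl //; try exact: integrable_abs_sub.
have h1 : M * \int[lam]_(s in D) `|g' s - c'| <= M * (h * eta) by exact: ler_wpM2l.
have h2 : M' * \int[lam]_(s in D) `|g s - c| <= M' * (h * eta) by exact: ler_wpM2l.
apply: le_trans (lerD (lerD h1 h2) (lexx _)) _.
rewrite /K /M /M' le_eqVlt; apply/orP; left; apply/eqP; ring.
Qed.
End edge_estimate.

(** * The contact equation along one segment *)

Section edges.
Context {R : realType} {k : nat}.
Local Notation lam := (@lebesgue_measure R).
Local Notation V := 'rV[R]_k.
Implicit Types (u g : V -> R) (e w z : V) (h : R).

(** [u] is absolutely continuous on the segment from [w] to w + h e, with derivative
[g], after a change on a null set of parameters.  The end point is listed apart
because the corners of a square must match exactly. *)
Definition ac_edge u g e h w : Prop :=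
  [/\ lam.-integrable `[0, h] (EFin \o (fun s : R => g (w + s *: e))),
      u (w + h *: e) = running_integral (u w) (fun s => g (w + s *: e)) h &
      {ae lam, forall s : R, `[0, h]%classic s ->
        u (w + s *: e) = running_integral (u w) (fun s => g (w + s *: e)) s}].

(** For a side that starts at another corner than the base point, the starting
values [a], [a'] of [edge_estimate] are increments along a side from the base
point, hence close to h p and h p'. *)
Lemma far_edge_estimate (h eta p p' q q' a a' M : R) : 0 < h -> 0 <= eta ->
  `|a - h * p| <= h * eta -> `|a' - h * p'| <= h * eta ->
  `|M - h * (a * q' - a' * q)| <=
    h * eta * (`|a| + `|a'| + h * (`|q| + `|q'|) *+ 2 + h * eta *+ 2) ->
  `|M - h ^+ 2 * (p * q' - p' * q)| <=
    h ^+ 2 * (eta * (`|p| + `|p'| + `|q| + `|q'| + eta) *+ 4).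
Proof.
move=> h0 eta0 ap ap' hM.
have bnd b c : `|b - h * c| <= h * eta -> `|b| <= h * `|c| + h * eta.
  move=> bc; rewrite -[b](subrK (h * c)) addrC; apply: le_trans (ler_normD _ _) _.
  by apply: lerD => //; rewrite normrM gtr0_norm.
have -> : M - h ^+ 2 * (p * q' - p' * q) = (M - h * (a * q' - a' * q)) +
  (h * ((a - h * p) * q') - h * ((a' - h * p') * q)) by ring.
apply: le_trans (ler_normD _ _) _.
have h1 : `|h * ((a - h * p) * q') - h * ((a' - h * p') * q)| <=
    h * (h * eta * `|q'|) + h * (h * eta * `|q|).
  apply: le_trans (ler_normB _ _) _; rewrite !normrM (gtr0_norm h0).
  by apply: lerD; rewrite ler_wpM2l ?(ltW h0) // ler_wpM2r.
have h2 : h * eta * (`|a| + `|a'| + h * (`|q| + `|q'|) *+ 2 + h * eta *+ 2) <=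
    h * eta * ((h * `|p| + h * eta) + (h * `|p'| + h * eta) + h * (`|q| + `|q'|) *+ 2 + h * eta *+ 2).
  rewrite ler_wpM2l ?mulr_ge0 // ?(ltW h0) // !lerD2r.
  by apply: lerD; exact: bnd.
apply: le_trans (lerD (le_trans hM h2) h1) _.
rewrite -subr_ge0.
have -> : h ^+ 2 * (eta * (`|p| + `|p'| + `|q| + `|q'| + eta) *+ 4) -
  (h * eta * ((h * `|p| + h * eta) + (h * `|p'| + h * eta) + h * (`|q| + `|q'|) *+ 2 + h * eta *+ 2)
   + (h * (h * eta * `|q'|) + h * (h * eta * `|q|))) =
  h ^+ 2 * eta * (`|p| *+ 3 + `|p'| *+ 3 + `|q| + `|q'|) by ring.
by rewrite !mulr_ge0 ?exprn_ge0 ?(ltW h0) // !addr_ge0 // mulrn_wge0.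
Qed.

Section contact_edge.
Context {n : nat} (x y : 'I_n -> V -> R) (t : V -> R).

Definition contact_edge (dx dy : 'I_n -> V -> R) (dt : V -> R) e h w : Prop :=
  [/\ forall j, ac_edge (x j) (dx j) e h w,
      forall j, ac_edge (y j) (dy j) e h w,
      ac_edge t dt e h w &
      {ae lam, forall s : R, `[0, h]%classic s -> let p := w + s *: e in
        dt p = - (2 * \sum_(j < n) (x j p * dy j p - y j p * dx j p))}].

(** The integral of x dy - y dx along the segment, for the curve (x, y) translated so
as to start at ([a], [b]). *)
Definition edge_form (dx dy : V -> R) e h w (a b : R) : R :=
  \int[lam]_(s in `[0, h])
    (running_integral a (fun s => dx (w + s *: e)) s * dy (w + s *: e) -
     running_integral b (fun s => dy (w + s *: e)) s * dx (w + s *: e)).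

(** The values [r], [r'] at the base point are subtracted from x and y to make the
starting values of order h.  The correction only involves increments of x and y,
which will cancel around a closed loop. *)
Lemma contact_edge_increment dx dy dt e h w (r r' : 'I_n -> R) : 0 < h ->
  contact_edge dx dy dt e h w ->
  t (w + h *: e) - t w = - (2 * \sum_(j < n)
    (edge_form (dx j) (dy j) e h w (x j w - r j) (y j w - r' j) +
     (r j * (y j (w + h *: e) - y j w) - r' j * (x j (w + h *: e) - x j w)))).
Proof.
move=> h0 [acx acy [it tE _] ct].
have mD : measurable (`[0, h]%classic : set (measurableTypeR R)) by [].
rewrite tE {1}/running_integral addrC addKr.
pose G j s := dx j (w + s *: e); pose G' j s := dy j (w + s *: e).
pose X j := running_integral (x j w) (G j); pose Y j := running_integral (y j w) (G' j).
have iG j : lam.-integrable `[0, h] (EFin \o G j) by have [] := acx j.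
have iG' j : lam.-integrable `[0, h] (EFin \o G' j) by have [] := acy j.
have iF j : lam.-integrable `[0, h] (EFin \o (fun s => X j s * G' j s - Y j s * G j s)).
  by apply: integrable_subR => //; exact: integrable_running_mul.
have iS := integrable_sumR (index_enum 'I_n) mD iF.
transitivity (\int[lam]_(s in `[0, h]) (- 2 * \sum_(j < n) (X j s * G' j s - Y j s * G j s))).
  apply: ae_eq_Rintegral => //.
  - by apply/measurable_EFinP; exact: measurable_int it.
  - apply: measurable_funM => //; apply/measurable_EFinP; exact: measurable_int iS.
  have ax : {ae lam, forall s : R, forall j, `[0, h]%classic s -> x j (w + s *: e) = X j s}.
    by apply: ae_forall => j; have [] := acx j.
  have ay : {ae lam, forall s : R, forall j, `[0, h]%classic s -> y j (w + s *: e) = Y j s}.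
    by apply: ae_forall => j; have [] := acy j.
  apply: ae_imp (ae_and ct (ae_and ax ay)) => s [ds [xs ys]] sD.
  rewrite ds // mulNr; congr (- (2 * _)); apply: eq_bigr => j _.
  by rewrite xs // ys.
rewrite RintegralZl // mulNr; congr (- (2 * _)).
rewrite Rintegral_sum //; apply: eq_bigr => j _.
rewrite /edge_form -/(G j) -/(G' j).
have [_ -> _] := acx j; have [_ -> _] := acy j.
rewrite -/(G j) -/(G' j) {3 4}/running_integral.
rewrite [y j w + _ - y j w]addrC [x j w + _ - x j w]addrC !addKr.
have mj := integrable_scaleR (r j) mD (iG' j).
have mj' := integrable_scaleR (r' j) mD (iG j).
have -> : r j * \int[lam]_(s in `[0, h]) G' j s - r' j * \int[lam]_(s in `[0, h]) G j s =
    \int[lam]_(s in `[0, h]) (r j * G' j s - r' j * G j s).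
  by rewrite RintegralB // !RintegralZl.
rewrite -RintegralD //; last 2 first.
- apply: integrable_subR => //; first exact: (integrable_running_mul h0 (iG j) (iG' j)).
  exact: (integrable_running_mul h0 (iG' j) (iG j)).
- exact: integrable_subR.
by apply: eq_Rintegral => s _; rewrite /X /Y /running_integral /G /G' /=; ring.
Qed.

End contact_edge.
End edges.

(** * The contact equation around a square *)

Section loop.
Context {R : realType} {k n : nat}.
Local Notation lam := (@lebesgue_measure R).
Local Notation V := 'rV[R]_k.
Variables (x y : 'I_n -> V -> R) (t : V -> R).
Variables (dxa dya dxb dyb : 'I_n -> V -> R) (dta dtb : V -> R).
Variables (a b z : V) (h eta : R).
Hypotheses (h0 : 0 < h) (eta0 : 0 <= eta).

Definition edge_error (g : V -> R) (e w p : V) (h : R) : R :=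
  \int[lam]_(s in `[0, h]) `|g (w + s *: e) - g p|.

Hypothesis e1 : contact_edge x y t dxa dya dta a h z.
Hypothesis e2 : contact_edge x y t dxb dyb dtb b h (z + h *: a).
Hypothesis e3 : contact_edge x y t dxa dya dta a h (z + h *: b).
Hypothesis e4 : contact_edge x y t dxb dyb dtb b h z.

Hypothesis E1 : forall j, edge_error (dxa j) a z z h <= h * eta /\
  edge_error (dya j) a z z h <= h * eta.
Hypothesis E2 : forall j, edge_error (dxb j) b (z + h *: a) z h <= h * eta /\
  edge_error (dyb j) b (z + h *: a) z h <= h * eta.
Hypothesis E3 : forall j, edge_error (dxa j) a (z + h *: b) z h <= h * eta /\
  edge_error (dya j) a (z + h *: b) z h <= h * eta.
Hypothesis E4 : forall j, edge_error (dxb j) b z z h <= h * eta /\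
  edge_error (dyb j) b z z h <= h * eta.

Let omega j := dxa j z * dyb j z - dya j z * dxb j z.
Let S j := `|dxa j z| + `|dya j z| + `|dxb j z| + `|dyb j z|.

Lemma ac_edge_increment_approx (u g : V -> R) (e : V) : ac_edge u g e h z ->
  edge_error g e z z h <= h * eta ->
  `|u (z + h *: e) - u z - h * g z| <= h * eta.
Proof.
move=> [ig -> _]; apply: le_trans.
have hD : h \in (`[0, h]%classic : set R) by rewrite inE /= in_itv /= lexx ltW.
have := running_integral_approx h0 ig (u z) (g z) hD.
by rewrite opprD addrA (mulrC h).
Qed.

(** The increments of t, x and y around the square cancel, so the four integrals of
x dy - y dx add up to 0.  The two sides at z contribute only errors, the other
two contribute h ^ 2 omega each, up to errors. *)
Lemma loop_estimate :
  `|\sum_(j < n) omega j| <= (\sum_(j < n) eta * (S j + eta)) *+ 6.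
Proof.
pose M1 j := edge_form (dxa j) (dya j) a h z 0 0.
pose M2 j := edge_form (dxb j) (dyb j) b h (z + h *: a)
  (x j (z + h *: a) - x j z) (y j (z + h *: a) - y j z).
pose M3 j := edge_form (dxa j) (dya j) a h (z + h *: b)
  (x j (z + h *: b) - x j z) (y j (z + h *: b) - y j z).
pose M4 j := edge_form (dxb j) (dyb j) b h z 0 0.
have corner : z + h *: a + h *: b = z + h *: b + h *: a by rewrite addrAC.
have loop : \sum_(j < n) (M1 j + M2 j - M3 j - M4 j) = 0.
  pose r j := x j z; pose r' j := y j z.
  have I1 := contact_edge_increment r r' h0 e1.
  have I2 := contact_edge_increment r r' h0 e2.
  have I3 := contact_edge_increment r r' h0 e3.
  have I4 := contact_edge_increment r r' h0 e4.
  rewrite corner in I2.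
  have := congr2 +%R (congr2 +%R I1 I2) (congr2 +%R (congr1 -%R I3) (congr1 -%R I4)).
  set T1 := \sum_(j < n) _; set T2 := \sum_(j < n) _; set T3 := \sum_(j < n) _.
  set T4 := \sum_(j < n) _ => TE.
  have -> : \sum_(j < n) (M1 j + M2 j - M3 j - M4 j) = T1 + T2 - T3 - T4.
    rewrite /T1 /T2 /T3 /T4 -big_split /= -!sumrB; apply: eq_bigr => j _.
    rewrite /M1 /M2 /M3 /M4 /r /r' !subrr; ring.
  have : 2 * (T1 + T2 - T3 - T4) = 0 by move: TE; lra.
  by move=> /eqP; rewrite mulf_eq0 pnatr_eq0 /= => /eqP.
have acx1 j : ac_edge (x j) (dxa j) a h z by have [] := e1.
have acy1 j : ac_edge (y j) (dya j) a h z by have [] := e1.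
have acx4 j : ac_edge (x j) (dxb j) b h z by have [] := e4.
have acy4 j : ac_edge (y j) (dyb j) b h z by have [] := e4.
have acx2 j : ac_edge (x j) (dxb j) b h (z + h *: a) by have [] := e2.
have acy2 j : ac_edge (y j) (dyb j) b h (z + h *: a) by have [] := e2.
have acx3 j : ac_edge (x j) (dxa j) a h (z + h *: b) by have [] := e3.
have acy3 j : ac_edge (y j) (dya j) a h (z + h *: b) by have [] := e3.
have near0 j : 0 <= h ^+ 2 * eta * (`|dxb j z| + `|dyb j z|).
  by rewrite !mulr_ge0 ?exprn_ge0 ?(ltW h0) ?addr_ge0.
have near0' j : 0 <= h ^+ 2 * eta * (`|dxa j z| + `|dya j z|).
  by rewrite !mulr_ge0 ?exprn_ge0 ?(ltW h0) ?addr_ge0.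
have B1 j : `|M1 j| <= h ^+ 2 * (eta * (S j + eta)) *+ 2.
  have [i _ _] := acx1 j; have [i' _ _] := acy1 j; have [Ex Ey] := E1 j.
  have := edge_estimate 0 0 h0 eta0 i i' Ex Ey.
  rewrite !mul0r subrr mulr0 subr0 normr0 => /le_trans; apply.
  rewrite -subr_ge0; apply: le_trans (_ : 0 <= _ *+ 2) _; first exact: mulrn_wge0 (near0 j).
  rewrite le_eqVlt /S; apply/orP; left; apply/eqP; ring.
have B4 j : `|M4 j| <= h ^+ 2 * (eta * (S j + eta)) *+ 2.
  have [i _ _] := acx4 j; have [i' _ _] := acy4 j; have [Ex Ey] := E4 j.
  have := edge_estimate 0 0 h0 eta0 i i' Ex Ey.
  rewrite !mul0r subrr mulr0 subr0 normr0 => /le_trans; apply.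
  rewrite -subr_ge0; apply: le_trans (_ : 0 <= _ *+ 2) _; first exact: mulrn_wge0 (near0' j).
  rewrite le_eqVlt /S; apply/orP; left; apply/eqP; ring.
have B2 j : `|M2 j - h ^+ 2 * omega j| <= h ^+ 2 * (eta * (S j + eta)) *+ 4.
  have [i _ _] := acx2 j; have [i' _ _] := acy2 j; have [Ex Ey] := E2 j.
  have [Fx Fy] := E1 j.
  have := far_edge_estimate h0 eta0 (ac_edge_increment_approx (acx1 j) Fx)
    (ac_edge_increment_approx (acy1 j) Fy) (edge_estimate _ _ h0 eta0 i i' Ex Ey).
  move=> /le_trans; apply.
  rewrite le_eqVlt /S; apply/orP; left; apply/eqP; ring.
have B3 j : `|M3 j + h ^+ 2 * omega j| <= h ^+ 2 * (eta * (S j + eta)) *+ 4.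
  have [i _ _] := acx3 j; have [i' _ _] := acy3 j; have [Ex Ey] := E3 j.
  have [Fx Fy] := E4 j.
  have := far_edge_estimate h0 eta0 (ac_edge_increment_approx (acx4 j) Fx)
    (ac_edge_increment_approx (acy4 j) Fy) (edge_estimate _ _ h0 eta0 i i' Ex Ey).
  have -> : dxb j z * dya j z - dyb j z * dxa j z = - omega j by rewrite /omega; ring.
  rewrite mulrN opprK => /le_trans; apply.
  rewrite le_eqVlt /S; apply/orP; left; apply/eqP; ring.
have key : `|(h ^+ 2 * \sum_(j < n) omega j) *+ 2| <=
    (h ^+ 2 * \sum_(j < n) eta * (S j + eta)) *+ 12.
  have -> : (h ^+ 2 * \sum_(j < n) omega j) *+ 2 =
      \sum_(j < n) ((M3 j + h ^+ 2 * omega j) - (M2 j - h ^+ 2 * omega j) - M1 j + M4 j).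
    transitivity (\sum_(j < n) (h ^+ 2 * omega j *+ 2) - \sum_(j < n) (M1 j + M2 j - M3 j - M4 j)).
      by rewrite loop subr0 mulr_sumr sumrMnl.
    by rewrite -sumrB; apply: eq_bigr => j _; ring.
  apply: le_trans (ler_norm_sum _ _ _) _.
  rewrite mulr_sumr -sumrMnl; apply: ler_sum => j _.
  apply: le_trans (ler_normD _ _) _; apply: le_trans (lerD (ler_normB _ _) (lexx _)) _.
  apply: le_trans (lerD (lerD (ler_normB _ _) (lexx _)) (lexx _)) _.
  apply: le_trans (lerD (lerD (lerD (B3 j) (B2 j)) (B1 j)) (B4 j)) _.
  by rewrite -!mulrnDr.
have h20 : 0 < h ^+ 2 by rewrite exprn_gt0.
rewrite -(ler_pM2l h20) -(ler_pMn2r (n := 2)) //.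
move: key; rewrite normrMn normrM (gtr0_norm h20) => /le_trans; apply.
by rewrite le_eqVlt; apply/orP; left; apply/eqP; ring.
Qed.

End loop.

(** * Averaged oscillation of the derivatives *)

Section ae_small.
Context (R : realType) d (T : measurableType d) (m : {measure set T -> \bar R}).
Variable F : nat -> T -> \bar R.

(** Chebyshev's inequality: the set where all [F i] exceed [eta] has measure at most
eps / eta for every eps. *)
Lemma ae_exists_small : (forall i, measurable_fun setT (F i)) -> (forall i x, 0 <= F i x)%E ->
  (forall eps : R, 0 < eps -> exists i, (\int[m]_x F i x <= eps%:E)%E) ->
  {ae m, forall x, forall eta : R, 0 < eta -> exists i, (F i x <= eta%:E)%E}.
Proof.
move=> mF F0 Fsmall.
have : {ae m, forall x, forall p : nat, exists i, (F i x <= (p.+1%:R^-1)%:E)%E}.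
  apply: ae_forall => p; pose c : R := p.+1%:R^-1.
  have c0 : 0 < c by rewrite invr_gt0.
  pose A := \bigcap_i [set x | (c%:E < F i x)%E].
  have mA : measurable A.
    apply: bigcapT_measurable => i; rewrite -[X in measurable X]setTI.
    by apply: measurable_lte => //; exact: measurable_cst.
  have A0 : m A = 0.
    apply/eqP; rewrite eq_le measure_ge0 andbT.
    apply/lee_addgt0Pr => eps e0; rewrite add0e.
    have [i Fi] := Fsmall (c * eps) (mulr_gt0 c0 e0).
    rewrite -(@lee_pmul2l _ c%:E) // -EFinM; apply: le_trans Fi.
    rewrite -integral_cst //; apply: (@le_trans _ _ (\int[m]_(x in A) F i x)%E).
      apply: ge0_le_integral => //.
      + by move=> x _; rewrite lee_fin ltW.
      + exact: measurable_funTS.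
      + by move=> x /(_ i I) /= /ltW.
    by apply: ge0_subset_integral.
  have := ae_measure0 mA A0; apply: ae_imp => x nA.
  apply: contrapT => h; apply: nA => i _ /=; rewrite ltNge.
  by apply/negP => Fi; apply: h; exists i.
apply: ae_imp => x h eta eta0.
pose p := Num.truncn eta^-1.
have ple : p.+1%:R^-1 <= eta.
  by rewrite invf_ple ?posrE // ltW // truncnS_gt.
by have [i Fi] := h p; exists i; apply: le_trans Fi _; rewrite lee_fin.
Qed.
End ae_small.

Section avg_error.
Context {R : realType} {k : nat}.
Local Notation mu := (@lebesgue_rV R k).
Local Notation lam := (@lebesgue_measure R).
Local Notation V := 'rV[R]_k.
Implicit Types (g : V -> R) (e z : V) (h tau : R).

(** The average oscillation of [g] on a side of length [h], relative to its value at
[z].  The side starts at [z] if [tau] is 0, and at the neighbouring corner z + h e'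
if [tau] is 1. *)
Definition avg_error g e (e' : V) tau h z : \bar R :=
  ((h^-1)%:E * \int[lam]_(s in `[0%R, h]) `|(g (z + (tau * h) *: e' + s *: e)%R - g z)%:E|)%E.

Lemma avg_error_ge0 g e (e' : V) tau h z : 0 < h -> (0 <= avg_error g e e' tau h z)%E.
Proof. by move=> h0; rewrite mule_ge0 ?integral_ge0 // lee_fin invr_ge0 ltW. Qed.

Let measurable_increment g e (v : V) : measurable_fun setT g ->
  measurable_fun setT (fun p : V * measurableTypeR R =>
    `|(g (p.1 + v + (p.2 : R) *: e) - g p.1)%:E|%E).
Proof.
move=> mg; apply: measurableT_comp => //; apply/measurable_EFinP.
apply: measurable_funB; last exact: (measurableT_comp mg measurable_fst).
apply: (eq_measurable_fun (fun p : V * measurableTypeR R =>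
  (fun z => g (z + v)) (p.1 + (p.2 : R) *: e))).
  by move=> p _; rewrite addrAC.
exact: (measurable_fun_line e (measurable_fun_shift v mg)).
Qed.

Lemma measurable_avg_error g e (e' : V) tau h : measurable_fun setT g ->
  measurable_fun setT (avg_error g e e' tau h).
Proof.
move=> mg; apply: emeasurable_funM; first exact: measurable_cst.
exact: (@measurable_fun_integral_in _ _ _ _ _ lam `[0%R, h] _ (measurable_itv _)
  (measurable_increment e ((tau * h) *: e') mg)).
Qed.

(** The increment of [g] from z to a point of the side splits into one along e' and
one along e; the L^1 norm of each is a translation defect. *)
Lemma avg_error_small g e (e' : V) tau (eps : R) : mu.-integrable setT (EFin \o g) ->
  0 <= tau <= 1 -> 0 < eps ->
  \forall h \near 0^'+, (\int[mu]_z avg_error g e e' tau h z <= eps%:E)%E.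
Proof.
move=> ig /andP[tau0 tau1] e0; have mg := integrable_measurable_real ig.
have e20 : 0 < eps / 2 by rewrite divr_gt0.
have [d1 d10 D1] := translation_defect_small e ig e20.
have [d2 d20 D2] := translation_defect_small e' ig e20.
near=> h.
have h0 : 0 < h by near: h; exact: nbhs_right_gt.
have hd1 : h <= d1 by near: h; exact: nbhs_right_le.
have hd2 : h <= d2 by near: h; exact: nbhs_right_le.
have mD : measurable (`[0, h]%classic : set (measurableTypeR R)) by [].
set v := (tau * h) *: e'.
have mI := measurable_increment e v mg.
rewrite /avg_error ge0_integralZl_EFin ?invr_ge0 ?(ltW h0) //; last 2 first.
- by move=> z _; exact: integral_ge0.
- exact: (@measurable_fun_integral_in _ _ _ _ _ lam `[0%R, h] _ mD mI).
rewrite -(@lee_pmul2l _ h%:E) ?lte_fin // muleA -EFinM divff ?gt_eqF // mul1e.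
rewrite (@tonelli_in _ _ _ _ _ mu lam _ _ mD mI) //.
rewrite -EFinM mulrC EFinM -(lebesgue_measure_segment (ltW h0)) -integral_cst //.
apply: ge0_le_integral => //.
- by move=> s _; exact: integral_ge0.
- apply: measurable_funTS.
  exact: (@measurable_fun_fubini_tonelli_G _ _ _ _ _ mu _ mI).
- move=> s; rewrite /= in_itv /= => /andP[s0 sh].
  have m1 := measurable_translation_difference e s mg.
  have m2 := measurable_translation_difference e' (tau * h) mg.
  apply: (@le_trans _ _ (\int[mu]_z (`|(g (z + v + s *: e) - g (z + v))%:E| + `|(g (z + v) - g z)%:E|))%E).
    apply: ge0_le_integral => //.
    + exact: (measurableT_comp mI (pair2_measurable s)).
    + by apply: emeasurable_funD => //; exact: (measurable_fun_shift v m1).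
    + move=> z _; rewrite !abse_EFin -EFinD lee_fin.
      rewrite -[g _ - g z](subrKA (g (z + v))); exact: ler_normD.
  rewrite ge0_integralD //; last exact: (measurable_fun_shift v m1).
  have -> : eps = eps / 2 + eps / 2 by field.
  rewrite EFinD; apply: leeD.
    rewrite (@ge0_integral_shift R k v _ m1) //.
    by apply: D1; rewrite s0 (le_trans sh).
  apply: D2; rewrite mulr_ge0 ?(ltW h0) //= (le_trans _ hd2) //.
  by rewrite ler_piMl // ltW.
Unshelve. all: by end_near. Qed.

End avg_error.

Section ae_family.
Context {R : realType} {k : nat}.
Local Notation mu := (@lebesgue_rV R k).
Local Notation lam := (@lebesgue_measure R).
Local Notation V := 'rV[R]_k.

(** The scale depends on the point [z], but at each point the same scale serves the
whole family. *)
Lemma ae_avg_errors_small (I : finType) (G : I -> V -> R) (e e' : I -> V) (tau : I -> R)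
    (rho : R) : 0 < rho -> (forall i, mu.-integrable setT (EFin \o G i)) ->
  (forall i, 0 <= tau i <= 1) ->
  {ae mu, forall z, forall eta : R, 0 < eta -> exists m : nat, forall i,
    (avg_error (G i) (e i) (e' i) (tau i) (rho / m.+1%:R) z <= eta%:E)%E}.
Proof.
move=> rho0 iG tau01.
have h0 m : 0 < rho / m.+1%:R by rewrite divr_gt0.
have mA i m : measurable_fun setT (avg_error (G i) (e i) (e' i) (tau i) (rho / m.+1%:R)).
  by apply: measurable_avg_error; exact: integrable_measurable_real.
pose F m z := (\sum_(i : I) avg_error (G i) (e i) (e' i) (tau i) (rho / m.+1%:R) z)%E.
have : {ae mu, forall z, forall eta : R, 0 < eta -> exists m, (F m z <= eta%:E)%E}.
  apply: ae_exists_small.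
  - move=> m; apply: emeasurable_sum => i; exact: mA.
  - by move=> m z; apply: sume_ge0 => i _; exact: avg_error_ge0.
  move=> eps eps0; pose c := eps / (#|I|.+1)%:R.
  have c0 : 0 < c by rewrite divr_gt0.
  have : \forall h \near 0^'+, forall i, (\int[mu]_z avg_error (G i) (e i) (e' i) (tau i) h z <= c%:E)%E.
    by apply: filter_forall => i; exact: avg_error_small.
  move=> [d /= d0 hd].
  pose m := Num.truncn (rho / d).
  have hm : rho / m.+1%:R < d by rewrite ltr_pdivrMr // mulrC -ltr_pdivrMr // truncnS_gt.
  exists m.
  rewrite ge0_integral_sum //; last by move=> i z _; exact: avg_error_ge0.
  apply: (@le_trans _ _ (\sum_(i : I) c%:E)%E).
    apply: lee_sum => i _; apply: (hd (rho / m.+1%:R) _ (h0 m)).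
    by rewrite /= sub0r normrN gtr0_norm.
  rewrite sumEFin lee_fin sumr_const /c -mulrnAl ler_pdivrMr ?ltr0n //.
  by rewrite -mulr_natr ler_wpM2l ?(ltW eps0) // ler_nat leqW // max_card.
apply: ae_imp => z Fz eta eta0; have [m Fm] := Fz eta eta0.
exists m => i; apply: le_trans Fm; rewrite /F (bigD1 i) //=.
rewrite leeDl // sume_ge0 // => j _; exact: avg_error_ge0.
Qed.

End ae_family.

(** * Absolute continuity on almost every segment *)

Section ae_edges.
Context {R : realType} {k : nat}.
Local Notation mu := (@lebesgue_rV R k).
Local Notation lam := (@lebesgue_measure R).
Local Notation V := 'rV[R]_k.

Variables (u g : V -> R) (i : 'I_k) (l3 u3 : V).
Hypothesis iu : mu.-integrable setT (EFin \o u).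
Hypothesis ig : mu.-integrable setT (EFin \o g).
Hypothesis ug : forall l r (m : nat), cbox l r `<=` cbox l3 u3 ->
  (\int[mu]_z (- (u z * partial i (box_bump l r m.+1%:R) z))%:E =
   \int[mu]_z (g z * box_bump l r m.+1%:R z)%:E)%E.
Local Notation e := (delta_mx 0 i : V).

(** For each s the difference formula holds off a null set of z that depends on s.
Fubini's theorem for null sets exchanges the quantifiers; it asks for the joint
measurability of the line integral over [0, s] in (z, s). *)
Lemma ae_ac_edge l2 u2 (h : R) : 0 < h ->
  (forall t, 0 <= t <= h -> cbox (l2 + t *: e) (u2 + t *: e) `<=` cbox l3 u3) ->
  {ae mu, forall z, obox l2 u2 z -> ac_edge u g e h z}.
Proof.
move=> h0 sub.
have mg := integrable_measurable_real ig; have measu := integrable_measurable_real iu.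
have mD : measurable (`[0, h]%classic : set (measurableTypeR R)) by [].
have Doo : (lam `[0%R, h] < +oo)%E by rewrite lebesgue_measure_segment ?ltry // ltW.
have A1 := ae_line_integrable e mD Doo ig.
have A2 := difference_formula iu ig ug h0 sub.
pose P z (s : R) := obox l2 u2 z -> 0 < s <= h ->
  u (z + s *: e) - u z = line_integral g e `[0, s] z.
have A3 : {ae mu, forall z, {ae lam, forall s : R, P z s}}.
  apply: (@ae_sections _ _ _ _ _ mu lam (fun z (s : R) => P z s)).
    (* the integral over [0, s], written over an interval that does not depend on s *)
    pose J (p : V * measurableTypeR R) : R :=
      fine (\int[lam]_(t in `[0%R, h]) (g (p.1 + t *: e) * (t <= p.2 :> R)%R%:R)%:E)%E.
    pose W (p : V * measurableTypeR R) : R := u (p.1 + (p.2 : R) *: e) - u p.1 - J p.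
    have mJ : measurable_fun setT J.
      have mF : measurable_fun setT (fun q : (V * measurableTypeR R) * measurableTypeR R =>
          (g (q.1.1 + (q.2 : R) *: e) * ((q.2 : R) <= q.1.2)%R%:R)%:E).
        apply/measurable_EFinP; apply: measurable_funM.
          apply: (measurableT_comp (measurable_fun_line e mg)
            (g := fun q : (V * measurableTypeR R) * measurableTypeR R => (q.1.1, q.2))).
          apply: measurable_fun_pair => //.
          exact: (measurableT_comp measurable_fst measurable_fst).
        rewrite (_ : (fun q => _) = (\1_[set q : (V * measurableTypeR R) * measurableTypeR R |
            (q.2 : R) <= q.1.2] : _ -> R)); last first.
          by apply/funext => q; rewrite indicE mem_setE.
        apply: measurable_indic; rewrite -[X in measurable X]setTI.
        apply: measurable_fun_le => //.
        exact: (measurableT_comp measurable_snd measurable_fst).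
      have := @measurable_fun_integral_in _ _ _ _ _ lam `[0%R, h] _ mD mF.
      move=> /= mI; exact: (measurableT_comp _ mI).
    have mW : measurable_fun setT W.
      apply: measurable_funB => //; apply: measurable_funB; first exact: measurable_fun_line.
      exact: (measurableT_comp measu measurable_fst).
    have -> : [set p | ~ P p.1 p.2] = (obox l2 u2 `*` `]0, h]%classic) `&` (W @^-1` (~` [set 0])).
      have JE z (s : R) : 0 < s <= h -> J (z, s) = line_integral g e `[0, s] z.
        move=> /andP[s0 sh]; rewrite /J /line_integral /Rintegral; congr fine.
        rewrite [LHS]integral_mkcond [RHS]integral_mkcond; apply: eq_integral => t _.
        have E c : (t \in (`[0, c]%classic : set (measurableTypeR R))) = (0 <= (t : R) <= c).
          by apply/idP/idP; rewrite inE /= in_itv.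
        rewrite /patch !E /=; case: (0 <= (t : R)) => //=.
        case: (leP (t : R) s) => ts; first by rewrite (le_trans ts sh) mulr1.
        by rewrite mulr0 if_same.
      apply/seteqP; split=> [[z s] /=|[z s] /= [[zb]]].
        move=> /not_implyP[zb /not_implyP[s0h ne]]; split; first by split=> //; rewrite in_itv.
        by move=> W0; apply: ne; apply/eqP; rewrite -subr_eq0 -JE //; apply/eqP.
      rewrite in_itv /= => s0h Wn0 /(_ zb s0h) E; apply: Wn0.
      by rewrite /W /= JE // E subrr.
    apply: measurableI; first by apply: measurableX => //; exact: measurable_obox.
    rewrite -[X in measurable X]setTI; apply: mW => //; exact: measurableC.
  move=> s; have [/andP[s0 sh]|ns] := boolP (0 < s <= h); last first.
    by apply: aeW => z; rewrite /P => _ /idPn; rewrite ns.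
  have sub' t : 0 <= t <= s -> cbox (l2 + t *: e) (u2 + t *: e) `<=` cbox l3 u3.
    by move=> /andP[t0 ts]; apply: sub; rewrite t0 (le_trans ts).
  by apply: ae_imp (difference_formula iu ig ug s0 sub') => z h1 zb _; exact: h1.
apply: ae_imp (ae_and A1 (ae_and A2 A3)) => z [iz [dz az]] zb; split => //.
  by rewrite /running_integral -[RHS]addrC; apply/eqP; rewrite -subr_eq; apply/eqP; exact: dz.
apply: ae_imp az => s sP; rewrite /= in_itv /= => /andP[s0 sh].
rewrite /running_integral.
move: s0; rewrite le_eqVlt => /predU1P[<-|s0].
  by rewrite scale0r addr0 set_itv1 Rintegral_set1 addr0.
have := sP zb; rewrite s0 sh => /(_ isT) /eqP.
by rewrite subr_eq [eqbRHS]addrC => /eqP.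
Qed.

End ae_edges.

(** * Isotropy of the weak differential on a cube *)

Section cubes.
Context {R : realType} {k : nat}.
Implicit Types (q z : 'rV[R]_k) (c d s : R) (i : 'I_k).

Definition ocube q c := obox (q - const_mx c) (q + const_mx c).
Definition ccube q c := cbox (q - const_mx c) (q + const_mx c).

Lemma ocubeP q c z : ocube q c z <-> forall i, `|z 0 i - q 0 i| < c.
Proof. by split=> h i; have := h i; rewrite !mxE distrC ltr_distlC. Qed.

Lemma ccubeP q c z : ccube q c z <-> forall i, `|z 0 i - q 0 i| <= c.
Proof. by split=> h i; have := h i; rewrite !mxE distrC ler_distlC. Qed.

Lemma norm_delta_mx_le s i j : `|(s *: delta_mx 0 i : 'rV[R]_k) 0 j| <= `|s|.
Proof. by rewrite !mxE eqxx /=; case: eqP; rewrite ?mulr1 // mulr0 normr0. Qed.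

Lemma ocube_shift q c d s i z : `|s| <= d -> ocube q c z ->
  ocube q (c + d) (z + s *: delta_mx 0 i).
Proof.
move=> sd /ocubeP zc; apply/ocubeP => j.
rewrite mxE addrAC; apply: le_lt_trans (ler_normD _ _) _.
by apply: ltr_leD => //; exact: le_trans (norm_delta_mx_le _ _ _) sd.
Qed.

Lemma ccube_shift q c d s i z : `|s| <= d -> ccube q c z ->
  ccube q (c + d) (z + s *: delta_mx 0 i).
Proof.
move=> sd /ccubeP zc; apply/ccubeP => j.
rewrite mxE addrAC; apply: le_trans (ler_normD _ _) _.
by apply: lerD => //; exact: le_trans (norm_delta_mx_le _ _ _) sd.
Qed.

Lemma sub_ocube_ccube q c : ocube q c `<=` ccube q c.
Proof. exact: sub_obox_cbox. Qed.

End cubes.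

Section local.
Context {R : realType} {k n : nat}.
Local Notation mu := (@lebesgue_rV R k).
Local Notation lam := (@lebesgue_measure R).
Local Notation V := 'rV[R]_k.

Definition weak_partial_on (B : set V) (i : 'I_k) (u g : V -> R) : Prop :=
  forall l r (m : nat), cbox l r `<=` B ->
  (\int[mu]_z (- (u z * partial i (box_bump l r m.+1%:R) z))%:E =
   \int[mu]_z (g z * box_bump l r m.+1%:R z)%:E)%E.

Lemma edge_error_le (g : V -> R) (e e' z : V) (tau h eta : R) : 0 < h -> 0 <= eta ->
  (avg_error g e e' tau h z <= eta%:E)%E ->
  edge_error g e (z + (tau * h) *: e') z h <= h * eta.
Proof.
move=> h0 eta0; rewrite /avg_error lee_pdivrMl // -EFinM => hle.
rewrite /edge_error /Rintegral -[leRHS]/(fine (h * eta)%:E) fine_le //.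
by rewrite ge0_fin_numE ?integral_ge0 // (le_lt_trans hle) ?ltry.
Qed.

Variables (x y : 'I_n -> V -> R) (t : V -> R).
Variables (dx dy : 'I_k -> 'I_n -> V -> R) (dt : 'I_k -> V -> R).
(** Three concentric cubes: the base points lie in the cube of radius [r], the
corners of the squares in that of radius 2 r, and the sides in that of radius
3 r, on which the hypotheses hold. *)
Variables (q : V) (r : R) (r0 : 0 < r).
Hypothesis ix : forall j, mu.-integrable setT (EFin \o x j).
Hypothesis iy : forall j, mu.-integrable setT (EFin \o y j).
Hypothesis it : mu.-integrable setT (EFin \o t).
Hypothesis idx : forall i j, mu.-integrable setT (EFin \o dx i j).
Hypothesis idy : forall i j, mu.-integrable setT (EFin \o dy i j).
Hypothesis idt : forall i, mu.-integrable setT (EFin \o dt i).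
Hypothesis wx : forall i j, weak_partial_on (ccube q (r + r + r)) i (x j) (dx i j).
Hypothesis wy : forall i j, weak_partial_on (ccube q (r + r + r)) i (y j) (dy i j).
Hypothesis wt : forall i, weak_partial_on (ccube q (r + r + r)) i t (dt i).
Hypothesis ct : forall i, {ae mu, forall z, ccube q (r + r + r) z ->
  dt i z = - (2 * \sum_(j < n) (x j z * dy i j z - y j z * dx i j z))}.

Local Notation e i := (delta_mx 0 i : V).

Lemma ae_contact_edge (i : 'I_k) (h : R) : 0 < h -> h <= r ->
  {ae mu, forall w, ocube q (r + r) w -> contact_edge x y t (dx i) (dy i) (dt i) (e i) h w}.
Proof.
move=> h0 hr.
have sub s : 0 <= s <= h -> cbox (q - const_mx (r + r) + s *: e i) (q + const_mx (r + r) + s *: e i)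
    `<=` ccube q (r + r + r).
  move=> /andP[s0 sh] z; rewrite cbox_shift => /ccube_shift.
  move=> /(_ r s i); rewrite subrK; apply.
  by rewrite ger0_norm // (le_trans sh).
have Ax : {ae mu, forall w, forall j, ocube q (r + r) w -> ac_edge (x j) (dx i j) (e i) h w}.
  by apply: ae_forall => j; apply: ae_ac_edge sub => //; exact: wx.
have Ay : {ae mu, forall w, forall j, ocube q (r + r) w -> ac_edge (y j) (dy i j) (e i) h w}.
  by apply: ae_forall => j; apply: ae_ac_edge sub => //; exact: wy.
have At : {ae mu, forall w, ocube q (r + r) w -> ac_edge t (dt i) (e i) h w}.
  by apply: ae_ac_edge sub => //; exact: wt.
have Ac := ae_line (e i) (ct i).
apply: ae_imp (ae_and Ax (ae_and Ay (ae_and At Ac))) => w [ax [ay [at_ ac]]] wc.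
split; [by move=> j; exact: ax|by move=> j; exact: ay|exact: at_|].
apply: ae_imp ac => s cs; rewrite /= in_itv /= => /andP[s0 sh].
apply: cs; apply: sub_ocube_ccube; apply: ocube_shift wc.
by rewrite ger0_norm // (le_trans sh).
Qed.

(** At almost every z all squares of sides r / (m + 1) at z satisfy the hypotheses of
[loop_estimate], and some of them have arbitrarily small errors. *)
Lemma local_isotropy (a b : 'I_k) : {ae mu, forall z, ocube q r z ->
  \sum_(j < n) (dx a j z * dy b j z - dy a j z * dx b j z) = 0}.
Proof.
pose h m : R := r / m.+1%:R.
have h0 m : 0 < h m by rewrite divr_gt0.
have hr m : h m <= r by rewrite ler_pdivrMr // ler_peMr ?(ltW r0) // ler1n.
pose good i m w := ocube q (r + r) w ->
  contact_edge x y t (dx i) (dy i) (dt i) (e i) (h m) w.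
have G i m : {ae mu, forall w, good i m w} := ae_contact_edge i (h0 m) (hr m).
have Ga : {ae mu, forall z, forall m, good a m z} := ae_forall (G a).
have Gb : {ae mu, forall z, forall m, good b m z} := ae_forall (G b).
have Gab : {ae mu, forall z, forall m, good b m (z + h m *: e a)}.
  by apply: ae_forall => m; exact: ae_shift (G b m).
have Gba : {ae mu, forall z, forall m, good a m (z + h m *: e b)}.
  by apply: ae_forall => m; exact: ae_shift (G a m).
(* a label (j, c, d, f) selects the pair j, its x- or y-coordinate, the direction
   a or b of the side, and whether the side starts away from z *)
pose I : finType := ('I_n * bool * bool * bool)%type.
pose dir (d : bool) := if d then a else b.
pose gf (l : I) : V -> R :=
  (if l.1.1.2 then dx else dy) (dir l.1.2) l.1.1.1.
have Esmall := @ae_avg_errors_small R k I gf (fun l => e (dir l.1.2)) (fun l => e (dir (~~ l.1.2)))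
  (fun l => l.2%:R) r r0.
have {}Esmall := Esmall _ _.
have igf l : mu.-integrable setT (EFin \o gf l).
  by rewrite /gf; case: ifP => _; [exact: idx|exact: idy].
have tau01 (l : I) : 0 <= (l.2%:R : R) <= 1 by case: l.2; rewrite ?lexx ?ler01.
have {}Esmall := Esmall igf tau01.
apply: ae_imp (ae_and Ga (ae_and Gb (ae_and Gab (ae_and Gba Esmall)))).
move=> z [ga [gb [gab [gba small]]]] zc.
set T := \sum_(j < n) _.
pose S j := `|dx a j z| + `|dy a j z| + `|dx b j z| + `|dy b j z|.
pose K := (\sum_(j < n) (S j + 1)) *+ 6.
have K0 : 0 <= K by rewrite mulrn_wge0 // sumr_ge0 // => j _; rewrite !addr_ge0.
have TK eta : 0 < eta -> eta <= 1 -> `|T| <= eta * K.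
  move=> eta0 eta1; have [m sm] := small eta eta0.
  have z2 : ocube q (r + r) z.
    have := ocube_shift (s := 0) a _ zc; rewrite scale0r addr0; apply.
    by rewrite normr0 ltW.
  have zs i : ocube q (r + r) (z + h m *: e i).
    by apply: ocube_shift zc; rewrite ger0_norm // ltW.
  have err j c d f := edge_error_le (h0 m) (ltW eta0) (sm (j, c, d, f)).
  have near_err j c d : edge_error (gf (j, c, d, false)) (e (dir d)) z z (h m) <= h m * eta.
    by have := err j c d false; rewrite /= mul0r scale0r addr0.
  have far_err j c d : edge_error (gf (j, c, d, true)) (e (dir d)) (z + h m *: e (dir (~~ d))) z (h m)
      <= h m * eta.
    by have := err j c d true; rewrite /= mul1r.
  have := @loop_estimate R k n x y t (dx a) (dy a) (dx b) (dy b) (dt a) (dt b) (e a) (e b) z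
    (h m) eta (h0 m) (ltW eta0) (ga m z2) (gab m (zs a)) (gba m (zs b)) (gb m z2).
  move=> /(_ (fun j => conj (near_err j true true) (near_err j false true))
    (fun j => conj (far_err j true false) (far_err j false false))
    (fun j => conj (far_err j true true) (far_err j false true))
    (fun j => conj (near_err j true false) (near_err j false false))).
  move=> /le_trans; apply.
  rewrite /K mulrnAr lerMn2r /= mulr_sumr; apply: ler_sum => j _.
  by rewrite ler_wpM2l ?(ltW eta0) // lerD2l.
apply/eqP; rewrite -normr_le0; apply/ler_addgt0Pr => eps eps0; rewrite add0r.
pose eta := Num.min 1 (eps / (K + 1)).
have eta0 : 0 < eta by rewrite lt_min ltr01 divr_gt0 // ltr_wpDl.
apply: le_trans (TK eta eta0 _) _; first by rewrite ge_min lexx.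
apply: (@le_trans _ _ (eps / (K + 1) * K)).
  by rewrite ler_wpM2r // ge_min lexx orbT.
by rewrite mulrAC ler_pdivrMr ?ltr_wpDl // ler_wpM2l ?(ltW eps0) // lerDl.
Qed.

End local.

(** * Rank of isotropic matrices *)

Section isotropic_rank.
Context {R : realType} {n : nat}.
Local Notation N := (2 * n).+1.
Implicit Types (v : 'rV[R]_N).

Definition xbasis : 'M[R]_(N, n) := \matrix_(i, j) (i == inord (2 * j))%:R.
Definition ybasis : 'M[R]_(N, n) := \matrix_(i, j) (i == inord (2 * j).+1)%:R.
Definition tbasis : 'M[R]_(N, 1) := \matrix_(i, j) (i == ord_max)%:R.

Let mul_basis m p (A : 'M[R]_(m, N)) (f : 'I_p -> 'I_N) i j :
  (A *m (\matrix_(l, j) (l == f j)%:R)) i j = A i (f j).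
Proof.
rewrite mxE (bigD1 (f j)) //= mxE eqxx mulr1 big1 ?addr0 // => l /negbTE lf.
by rewrite mxE lf mulr0.
Qed.

Lemma mul_xbasis m (A : 'M[R]_(m, N)) i j : (A *m xbasis) i j = A i (inord (2 * j)).
Proof. exact: mul_basis. Qed.

Lemma mul_ybasis m (A : 'M[R]_(m, N)) i j : (A *m ybasis) i j = A i (inord (2 * j).+1).
Proof. exact: mul_basis. Qed.

Lemma mul_tbasis m (A : 'M[R]_(m, N)) i j : (A *m tbasis) i j = A i ord_max.
Proof. exact: (mul_basis A (fun=> ord_max)). Qed.

Let val_x (j : 'I_n) : (inord (2 * j) : 'I_N) = (2 * j)%N :> nat.
Proof. by rewrite inordK //; have := ltn_ord j; lia. Qed.

Let val_y (j : 'I_n) : (inord (2 * j).+1 : 'I_N) = (2 * j).+1 :> nat.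
Proof. by rewrite inordK //; have := ltn_ord j; lia. Qed.

Lemma xbasis_ybasis : xbasis^T *m ybasis = 0.
Proof.
apply/matrixP => i j; rewrite mul_ybasis !mxE -val_eqE /= ?val_x ?val_y.
by case: eqP => //; lia.
Qed.

Lemma ybasis_xbasis : ybasis^T *m xbasis = 0.
Proof. by rewrite -[LHS]trmxK trmx_mul trmxK xbasis_ybasis trmx0. Qed.

Lemma xbasis_orthonormal : xbasis^T *m xbasis = 1%:M.
Proof.
apply/matrixP => i j; rewrite mul_xbasis !mxE -!val_eqE /= ?val_x ?val_y.
by congr (_%:R); case: eqP; case: eqP; lia.
Qed.

Lemma ybasis_orthonormal : ybasis^T *m ybasis = 1%:M.
Proof.
apply/matrixP => i j; rewrite mul_ybasis !mxE -!val_eqE /= ?val_x ?val_y.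
by congr (_%:R); case: eqP; case: eqP; lia.
Qed.

Lemma xbasis_tbasis : xbasis^T *m tbasis = 0.
Proof.
apply/matrixP => i j; rewrite mul_tbasis !mxE -val_eqE /= ?val_x ?val_y.
by case: eqP => //; have := ltn_ord i; lia.
Qed.

Lemma ybasis_tbasis : ybasis^T *m tbasis = 0.
Proof.
apply/matrixP => i j; rewrite mul_tbasis !mxE -val_eqE /= ?val_x ?val_y.
by case: eqP => //; have := ltn_ord i; lia.
Qed.

Lemma tbasis_orthonormal : tbasis^T *m tbasis = 1%:M.
Proof. by apply/matrixP => i j; rewrite mul_tbasis !mxE !ord1 eqxx. Qed.

Lemma basis_separates v : v *m xbasis = 0 -> v *m ybasis = 0 -> v *m tbasis = 0 -> v = 0.
Proof.
move=> vx vy vt; apply/rowP => i; rewrite mxE.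
have [i2n|i2n] := ltnP i (2 * n); last first.
  have -> : i = ord_max by apply: val_inj => /=; have := ltn_ord i; lia.
  by have := congr1 (fun A : 'M[R]_(1, 1) => A 0 0) vt; rewrite mul_tbasis mxE.
have jn : (i./2 < n)%N by lia.
have ij : i = inord (2 * Ordinal jn + odd i).
  by apply: val_inj; rewrite /= inordK; have := odd_double_half i; have := ltn_ord i; lia.
rewrite ij; case: (odd i).
  have := congr1 (fun A : 'M[R]_(1, n) => A 0 (Ordinal jn)) vy.
  by rewrite mul_ybasis mxE addn1.
have := congr1 (fun A : 'M[R]_(1, n) => A 0 (Ordinal jn)) vx.
by rewrite mul_xbasis mxE addn0.
Qed.

Variable p : 'rV[R]_N.

(** The column vector that represents the contact form at [p]. *)
Definition contact_covector : 'M[R]_(N, 1) :=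
  tbasis + 2 *: (ybasis *m (p *m xbasis)^T - xbasis *m (p *m ybasis)^T).

Lemma contact_covectorE m (A : 'M[R]_(m, N)) a b :
  (A *m contact_covector) a b = contact_form p (row a A).
Proof.
rewrite /contact_covector mulmxDr -scalemxAr mulmxBr !mulmxA mxE mul_tbasis.
rewrite /contact_form /tcoord mxE; congr (_ + _); first by rewrite mxE.
have E (U : 'M[R]_(m, n)) (w : 'rV[R]_n) : (U *m w^T) a b = \sum_j U a j * w 0 j.
  by rewrite mxE; apply: eq_bigr => j _; rewrite mxE ord1.
congr (2 * _); rewrite mxE [X in _ + X]mxE !E -sumrB; apply: eq_bigr => j _.
rewrite mul_ybasis mul_xbasis mul_xbasis mul_ybasis /xcoord /ycoord.
by rewrite [row a A 0 _]mxE [row a A 0 (inord (2 * j))]mxE; ring.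
Qed.

(** The matrix of the bilinear form omega(v, w) + alpha(v) dt(w), where omega is the
sum of the dx_j /\ dy_j and alpha is the contact form at [p].  The second term
removes the degeneracy of omega in the direction of t, and vanishes for v
horizontal. *)
Definition extended_form : 'M[R]_N :=
  xbasis *m ybasis^T - ybasis *m xbasis^T + contact_covector *m tbasis^T.

Lemma extended_form_free : row_free extended_form.
Proof.
apply: inj_row_free => v vB.
have eqB m (A : 'M[R]_(N, m)) : v *m (xbasis *m (ybasis^T *m A) - ybasis *m (xbasis^T *m A) +
    contact_covector *m (tbasis^T *m A)) = 0.
  by rewrite !mulmxA -mulmxBl -mulmxDl mulmxA vB mul0mx.
have tx : tbasis^T *m xbasis = 0 by rewrite -[LHS]trmxK trmx_mul trmxK xbasis_tbasis trmx0.
have ty : tbasis^T *m ybasis = 0 by rewrite -[LHS]trmxK trmx_mul trmxK ybasis_tbasis trmx0.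
have vx : v *m xbasis = 0.
  by have := eqB _ ybasis; rewrite ybasis_orthonormal xbasis_ybasis ty !mulmx0 subr0 addr0 mulmx1.
have vy : v *m ybasis = 0.
  have := eqB _ xbasis; rewrite ybasis_xbasis xbasis_orthonormal tx !mulmx0 sub0r addr0 mulmx1.
  by rewrite mulmxN => /eqP; rewrite oppr_eq0 => /eqP.
have vt : v *m tbasis = 0.
  have := eqB _ tbasis.
  rewrite ybasis_tbasis xbasis_tbasis tbasis_orthonormal !mulmx0 subr0 add0r mulmx1.
  rewrite /contact_covector mulmxDr -scalemxAr mulmxBr !mulmxA vx vy !mul0mx.
  by rewrite subrr scaler0 addr0.
exact: basis_separates.
Qed.

(** The extended form is nondegenerate and vanishes on the row space of [M], whose
dimension is therefore at most half of 2n + 1. *)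
Lemma rank_isotropic m (M : 'M[R]_(m, N)) :
  (forall a, contact_form p (row a M) = 0) ->
  (forall a b, \sum_(j < n) (M a (inord (2 * j)) * M b (inord (2 * j).+1) -
                             M a (inord (2 * j).+1) * M b (inord (2 * j))) = 0) ->
  (\rank M <= n)%N.
Proof.
move=> Mc Mo.
have Mc0 : M *m contact_covector = 0.
  by apply/matrixP => a b; rewrite contact_covectorE Mc mxE.
have B0 : M *m extended_form *m M^T = 0.
  rewrite /extended_form mulmxDr mulmxBr !mulmxA Mc0 mul0mx addr0 mulmxBl -!mulmxA -!trmx_mul.
  have E (U W : 'M[R]_(m, n)) a b : (U *m W^T) a b = \sum_j U a j * W b j.
    by rewrite mxE; apply: eq_bigr => j _; rewrite mxE.
  rewrite !mulmxA; apply/matrixP => a b; rewrite mxE [X in _ + X]mxE !E -sumrB mxE -[RHS](Mo a b).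
  by apply: eq_bigr => j _; rewrite !mul_xbasis !mul_ybasis.
have := mulmx0_rank_max B0.
by rewrite mxrankMfree ?extended_form_free // mxrank_tr; lia.
Qed.

End isotropic_rank.

(** * Integrable Borel representatives *)

Section nonmeasurable_integral.
Local Open Scope ereal_scope.
Context d (T : measurableType d) (R : realType) (m : {measure set T -> \bar R}).
Implicit Types f g : T -> \bar R.

Import HBNNSimple.

Let ge0_integral_le_off_null f g (N : set T) : measurable N -> m N = 0 ->
  (forall x, 0 <= f x) -> (forall x, 0 <= g x) -> (forall x, ~ N x -> f x = g x) ->
  \int[m]_x f x <= \int[m]_x g x.
Proof.
move=> mN N0 f0 g0 fg; rewrite !ge0_integralTE //.
apply: ge_ereal_sup => _ [h /= hf <-].
have mNC : measurable (~` N) by exact: measurableC.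
have E x : proj_nnsfun h mNC x = (h \_ (~` N))%R x by rewrite mrestrict.
apply: ereal_sup_ubound => /=; exists (proj_nnsfun h mNC).
  move=> x; rewrite E /patch; case: ifPn => [|_]; last exact: g0.
  by rewrite inE => nNx; rewrite -fg.
have <- := integralT_nnsfun m h; have <- := integralT_nnsfun m (proj_nnsfun h mNC).
apply: ae_eq_integral => //.
- exact/measurable_EFinP.
- exact/measurable_EFinP.
- exists N; split=> // x /= nE; apply: contrapT => nNx; apply: nE => _.
  by rewrite mindicE mem_set // mulr1.
Qed.

(** The integral of a nonnegative function, measurable or not, is a supremum over the
simple functions below it, and these may be replaced by 0 on a null Borel set. *)
Lemma ae_eq_integralT f g : {ae m, forall x, f x = g x} ->
  \int[m]_x f x = \int[m]_x g x.
Proof.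
move=> [N [mN N0 fgN]].
have fg x : ~ N x -> f x = g x by move=> nNx; apply: contrapT => ne; exact: nNx (fgN _ ne).
rewrite integralE [RHS]integralE; congr (_ - _); apply/eqP; rewrite eq_le;
  by apply/andP; split; apply: (ge0_integral_le_off_null mN N0) => // x nNx; rewrite ?funeposE ?funenegE fg.
Qed.

End nonmeasurable_integral.

Section localization.
Context {R : realType} {k : nat}.
Local Notation mu := (@lebesgue_rV R k).
Local Notation V := 'rV[R]_k.
Variables (Omega B : set V).
Hypotheses (cB : compact B) (mB : measurable B) (BO : B `<=` Omega).

(** [v] is an integrable representative of [u] on [B].  Being defined on the whole
space, it can be translated freely. *)
Definition localizes (u v : V -> R) : Prop :=
  mu.-integrable setT (EFin \o v) /\ {ae mu, forall z, B z -> v z = u z}.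

Lemma L1loc_localizes u : L1loc Omega u -> exists v, localizes u v.
Proof.
move=> [[w mw uw] uK].
have wu : {ae mu, forall z, B z -> w z = u z}.
  by apply: ae_imp uw => z uw Bz; rewrite uw //; exact: BO.
exists (w \_ B); split.
- have mwB : measurable_fun setT (w \_ B).
    by apply/(measurable_restrictT _ mB); exact: measurable_funTS.
  apply/integrableP; split; first exact/measurable_EFinP.
  apply: le_lt_trans (uK B BO cB).
  rewrite le_eqVlt; apply/orP; left; apply/eqP.
  rewrite [RHS]integral_mkcond; apply: ae_eq_integralT.
  apply: ae_imp wu => z wu; rewrite /patch /=; case: ifP => [|_]; last by rewrite normr0.
  by rewrite inE => Bz; rewrite wu.
- by apply: ae_imp wu => z wu Bz; rewrite /patch mem_set // wu.
Qed.

(** The test functions involved, and their derivatives, vanish off [B]. *)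
Lemma localizes_weak_partial (i : 'I_k) u g u1 g1 : weak_partial Omega i u g ->
  localizes u u1 -> localizes g g1 -> weak_partial_on B i u1 g1.
Proof.
move=> wug [iu1 u1u] [ig1 g1g] l r m lrB.
set phi := box_bump l r m.+1%:R.
have m0 : 0 < m.+1%:R :> R by rewrite ltr0n.
have tphi : test_function Omega phi.
  by apply: box_bump_test_function => //; exact: subset_trans BO.
have out z : ~ B z -> phi z = 0.
  move=> nBz; apply: box_bump_out => // zlr; apply: nBz; apply: lrB.
  exact: sub_obox_cbox zlr.
have dout z : ~ B z -> partial i phi z = 0.
  move=> nBz; apply: (partial_eq0 i (@closed_cbox R k l r)) => [y ny|]; last first.
    by move=> /lrB.
  by apply: box_bump_out => // ylr; apply: ny; exact: sub_obox_cbox.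
have loc (f f1 psi : V -> R) : localizes f f1 -> (forall z, ~ B z -> psi z = 0) ->
    (\int[mu]_(z in Omega) (f z * psi z)%:E = \int[mu]_z (f1 z * psi z)%:E)%E.
  move=> [_ f1f] psi0; rewrite integral_mkcond; apply: ae_eq_integralT.
  apply: ae_imp f1f => z f1f; rewrite /patch.
  have [Bz|nBz] := pselect (B z).
    by rewrite mem_set ?f1f //; exact: BO.
  by rewrite psi0 // !mulr0; case: ifP.
have Lu : localizes u u1 by split.
have Lg : localizes g g1 by split.
have := wug phi tphi; rewrite /Rintegral (loc u u1 _ Lu dout) (loc g g1 _ Lg out).
have [M pM] := test_function_partial_bounded i tphi.
have mphi : measurable_fun setT phi := measurable_box_bump l r m.+1%:R.
have mdphi : measurable_fun setT (partial i phi).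
  by apply: continuous_measurable_mx; exact: test_function_partial_continuous tphi.
have I1 := integrable_mul_bounded iu1 mdphi pM.
have I2 : mu.-integrable setT (fun x => (g1 x * phi x)%:E).
  by apply: (integrable_mul_bounded ig1 mphi (M := 1)) => z; rewrite ger0_norm ?box_bump_ge0 ?box_bump_le1.
move=> E; rewrite -[RHS]fineK ?integrable_fin_num //.
have -> : fine (\int[mu]_z (g1 z * phi z)%:E) = - fine (\int[mu]_z (u1 z * partial i phi z)%:E).
  by rewrite E opprK.
rewrite EFinN fineK ?integrable_fin_num //.
under eq_integral do rewrite EFinN -mulN1e.
by rewrite integralZl // mulN1e.
Qed.

End localization.

(** * The rank of the weak differential *)

Section cube_rank.
Context {R : realType} {k n : nat}.
Local Notation mu := (@lebesgue_rV R k).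
Local Notation V := 'rV[R]_k.
Variables (Omega : set V) (f : V -> 'rV[R]_(2 * n).+1) (Df : V -> 'M[R]_(k, (2 * n).+1)).
Hypothesis fW : W11loc Omega f.
Hypothesis fDf : is_weak_derivative Omega f Df.
Hypothesis contact : {ae mu, forall x, Omega x ->
  range (fun v : V => v *m Df x) `<=` contact_plane (f x)}.

Lemma ae_contact_rows :
  {ae mu, forall x, Omega x -> forall i, contact_form (f x) (row i (Df x)) = 0}.
Proof.
apply: ae_imp contact => x cx Ox i; apply: (cx Ox).
by exists (delta_mx 0 i) => //; rewrite rowE.
Qed.

Lemma cube_rank (q : V) (r : R) : 0 < r -> ccube q (r + r + r) `<=` Omega ->
  {ae mu, forall z, ocube q r z -> (\rank (Df z) <= n)%N}.
Proof.
move=> r0 BO; set B := ccube q (r + r + r).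
have cB : compact B by exact: compact_cbox.
have mB : measurable B.
  rewrite -(setCK B); apply: measurableC; apply: open_measurable_mx.
  by apply: closed_openC; exact: closed_cbox.
have [f1 f1P] := choice (fun j => L1loc_localizes cB mB BO (fW.1 j)).
have [g1 g1P] := choice (fun ij => L1loc_localizes cB mB BO (fDf ij.1 ij.2).1).
have wfg i j : weak_partial_on B i (f1 j) (g1 (i, j)).
  by apply: (localizes_weak_partial BO (fDf i j).2 (f1P j)); exact: g1P (i, j).
pose X (j : 'I_n) : 'I_(2 * n).+1 := inord (2 * j).
pose Y (j : 'I_n) : 'I_(2 * n).+1 := inord (2 * j).+1.
have f1E : {ae mu, forall z, forall j, B z -> f1 j z = f z 0 j}.
  by apply: ae_forall => j; have [] := f1P j.
have g1E : {ae mu, forall z, forall ij, B z -> g1 ij z = Df z ij.1 ij.2}.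
  by apply: ae_forall => ij; have [] := g1P ij.
have ct i : {ae mu, forall z, B z -> g1 (i, ord_max) z =
    - (2 * \sum_(j < n) (f1 (X j) z * g1 (i, Y j) z - f1 (Y j) z * g1 (i, X j) z))}.
  apply: ae_imp (ae_and ae_contact_rows (ae_and f1E g1E)) => z [cz [fz gz]] Bz.
  have := cz (BO _ Bz) i; rewrite /contact_form /tcoord mxE => /eqP.
  rewrite addr_eq0 => /eqP; rewrite gz //= => ->; congr (- (2 * _)).
  by apply: eq_bigr => j _; rewrite /xcoord /ycoord !mxE !fz // !gz.
have iso a b := @local_isotropy R k n (fun j => f1 (X j)) (fun j => f1 (Y j)) (f1 ord_max)
  (fun i j => g1 (i, X j)) (fun i j => g1 (i, Y j)) (fun i => g1 (i, ord_max)) q r r0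
  (fun j => let: conj h _ := f1P (X j) in h) (fun j => let: conj h _ := f1P (Y j) in h)
  (let: conj h _ := f1P ord_max in h)
  (fun i j => let: conj h _ := g1P (i, X j) in h)
  (fun i j => let: conj h _ := g1P (i, Y j) in h)
  (fun i => let: conj h _ := g1P (i, ord_max) in h)
  (fun i j => wfg i (X j)) (fun i j => wfg i (Y j)) (fun i => wfg i ord_max) ct a b.
have iso' := ae_forall (fun ab : 'I_k * 'I_k => iso ab.1 ab.2).
apply: ae_imp (ae_and ae_contact_rows (ae_and g1E iso')) => z [cz [gz isoz]] zr.
have Bz : B z.
  apply: sub_ocube_ccube; apply/ocubeP => i; move/ocubeP: zr => /(_ i) /lt_le_trans; apply.
  by rewrite lerDr addr_ge0 ?ltW.
apply: (rank_isotropic (p := f z)) => [a|a b]; first exact: cz (BO _ Bz) a.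
rewrite -[RHS](isoz (a, b) zr); apply: eq_bigr => j _.
by rewrite !gz.
Qed.

End cube_rank.

Section rational_cubes.
Context {R : realType} {k : nat}.
Implicit Types (x q : 'rV[R]_k).

Lemma open_rational_cube (Omega : set 'rV[R]_k) x : open Omega -> Omega x ->
  exists (q : 'rV[rat]_k) (m : nat), let r : R := m.+1%:R^-1 in
    ocube (map_mx ratr q) r x /\ ccube (map_mx ratr q) (r + r + r) `<=` Omega.
Proof.
move=> oO Ox.
have /nbhs_ballP[eps /= e0 eO] : nbhs x Omega by exact: open_nbhs_nbhs.
pose m := Num.truncn (5 / eps); pose r : R := m.+1%:R^-1.
have r0 : 0 < r by rewrite invr_gt0.
have re : 5 * r < eps.
  by rewrite ltr_pdivrMr // mulrC -ltr_pdivrMr // truncnS_gt.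
have /choice[q qP] : forall i : 'I_k, exists q : rat, `|x 0 i - ratr q| < r.
  move=> i.
  have xr : x 0 i - r < x 0 i + r by rewrite ltrBlDr -addrA ltrDl addr_gt0.
  have [q] := rat_in_itvoo xr.
  by rewrite in_itv /= => /andP[q1 q2]; exists q; rewrite ltr_distlC q1.
exists (\row_i q i), m; split.
  by apply/ocubeP => i; rewrite !mxE.
move=> y /ccubeP yq; apply: eO; split=> // i j; rewrite ord1 /ball /=.
have := yq j; rewrite !mxE -/r => yqj.
rewrite -(subrKA (ratr (q j))); apply: le_lt_trans (ler_normD _ _) _.
apply: lt_trans re.
rewrite [X in _ + X]distrC (_ : 5 * r = r + (r + r + r + r)); last by ring.
apply: ltr_leD; first exact: qP.
by apply: le_trans yqj _; rewrite lerDl ltW.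
Qed.

End rational_cubes.

Theorem theorem1p4 (R : realType) (k n : nat) (n_gt0 : (0 < n)%N)
    (n_lt_k : (n < k)%N) (Omega : set 'rV[R]_k) (openOmega : open Omega)
    (f : 'rV[R]_k -> 'rV[R]_(2 * n).+1) (fW : W11loc Omega f)
    (Df : 'rV[R]_k -> 'M[R]_(k, (2 * n).+1))
    (fDf : is_weak_derivative Omega f Df)
    (contact : {ae lebesgue_rV k, forall x, Omega x ->
       range (fun v : 'rV[R]_k => v *m Df x) `<=` contact_plane (f x)}) :
  {ae lebesgue_rV k, forall x, Omega x -> (\rank (Df x) <= n)%N}.
Proof.
pose P (qm : 'rV[rat]_k * nat) (z : 'rV[R]_k) : Prop :=
  let r : R := qm.2.+1%:R^-1 in
  ccube (map_mx ratr qm.1) (r + r + r) `<=` Omega ->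
  ocube (map_mx ratr qm.1) r z -> (\rank (Df z) <= n)%N.
have : {ae lebesgue_rV k, forall z, forall qm, P qm z}.
  apply: ae_forall => -[q m].
  have [sub|nsub] := pselect (ccube (map_mx ratr q)
    ((m.+1%:R^-1 : R) + m.+1%:R^-1 + m.+1%:R^-1) `<=` Omega).
    have r0 : 0 < (m.+1%:R^-1 : R) by rewrite invr_gt0.
    by apply: ae_imp (cube_rank fW fDf contact r0 sub) => z h; exact: (fun _ => h).
  by apply: aeW => z; exact: (fun sub => False_ind _ (nsub sub)).
apply: ae_imp => z Pz Oz.
have [q [m [zq qO]]] := open_rational_cube openOmega Oz.
exact: Pz (q, m) qO zq.
Qed.
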